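(* Let $\Omega_0,\mathbb{Y}^1,\dots,\mathbb{Y}^n,\mathbb{U}^1,\dots,\mathbb{U}^n$ be standard Borel spaces and let $\mu$ be a probability measure on $\Omega_0\times\mathbb{Y}^1\times\cdots\times\mathbb{Y}^n$. If the set $L_R(\mu)$ is compact under the weak convergence topology on $\mathcal{P}\big(\Omega_0\times\prod_{k=1}^n(\mathbb{Y}^k\times\mathbb{U}^k)\big)$, then $L_C(\mu)$ is compact under the weak convergence topology.
   Context: A team policy is $\bar\gamma=(\gamma^1,\dots,\gamma^n)$ with $\gamma^k:\mathbb{Y}^k\to\mathbb{U}^k$ measurable; its strategic measure $L_A(\mu,\bar\gamma)$ is the probability measure on $\Omega_0\times\prod_k(\mathbb{Y}^k\times\mathbb{U}^k)$ given by $L_A(\mu,\bar\gamma)(B)=\int \mu(d\omega_0,dy^1,\dots,dy^n)\,1_{\{(\omega_0,y^1,\gamma^1(y^1),\dots,y^n,\gamma^n(y^n))\in B\}}$, and $L_A(\mu)$ is the set of all such measures. $L_R(\mu)$ is the set of probability measures $P$ on $\Omega_0\times\prod_k(\mathbb{Y}^k\times\mathbb{U}^k)$ of the form $P(B)=\int_B\mu(d\omega_0,dy^1,\dots,dy^n)\prod_{k=1}^n\kappa^k(du^k|y^k)$, where each $\kappa^k$ is a stochastic kernel from $\mathbb{Y}^k$ to $\mathbb{U}^k$ (independently randomized policies). With $\mathcal{W}=[0,1]^n$, $L_C(\mu)$ is the set of probability measures $P$ of the form $P(B)=\int\eta(dz)\,L_A(\mu,\tilde\gamma(z))(B)$, where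 $\eta\in\mathcal{P}(\mathcal{W})$ and $z\mapsto\tilde\gamma(z)$ is a family of team policies such that $z\mapsto L_A(\mu,\tilde\gamma(z))$ is Borel measurable; equivalently, $P(B)=\int_{B\times\mathcal{W}}\eta(dz)\mu(d\omega_0,d\bar y)\prod_k\Pi^k(du^k|y^k,z)$ for some $\eta\in\mathcal{P}(\mathcal{W})$ and stochastic kernels $\Pi^k$ from $\mathbb{Y}^k\times\mathcal{W}$ to $\mathbb{U}^k$ (randomized policies with common randomness). *)

(* Defs.v *)
From HB Require Import structures.
From mathcomp Require Import all_boot all_order all_algebra.
From mathcomp Require Import all_classical all_reals all_analysis.
Set Implicit Arguments. Unset Strict Implicit. Unset Printing Implicit Defensive.
Import Order.TTheory GRing.Theory Num.Theory.
Import numFieldNormedType.Exports.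
Local Open Scope classical_set_scope.
Local Open Scope ring_scope.

Definition borel (T : ptopologicalType) : Type := g_sigma_algebraType (@open T).

Definition dprod (I : Type) (T : I -> ptopologicalType) : Type := prod_topology T.
HB.instance Definition _ (I : Type) (T : I -> ptopologicalType) :=
  Topological.on (dprod T).
HB.instance Definition _ (I : Type) (T : I -> ptopologicalType) :=
  isPointed.Build (dprod T) (fun i => point).

HB.instance Definition _ (P Q : ptopologicalType) := Topological.on (P * Q)%type.

(** Polish space: a complete (pseudo)metric space which is Hausdorff (hence
    a genuine complete metric space) and separable. *)
Definition polish (R : realType) (T : completePseudoMetricType R) : Prop :=
  hausdorff_space T /\ exists D : set T, countable D /\ dense D.

Section weak_topology_of_measures.
Variables (R : realType) (X : ptopologicalType).

Definition bcfun : Type :=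
  {f : X -> R | continuous f /\ exists M : R, forall x, `|f x| <= M}.

Definition prob_integral (P : probability (borel X) R) : {ptws bcfun -> R} :=
  fun f => fine (\int[P]_x ((sval f) x)%:E)%E.

Definition weakP : Type := initial_topology prob_integral.
End weak_topology_of_measures.

Section team.
Variables (R : realType) (n : nat) (Om : ptopologicalType)
  (Y U : 'I_n -> ptopologicalType).

Definition YS : ptopologicalType := dprod Y.
Definition MS : ptopologicalType := (Om * YS)%type.
Definition XS : ptopologicalType := (Om * dprod (fun k => (Y k * U k)%type))%type.

Definition team_policy : Type := forall k : 'I_n, Y k -> U k.

Definition measurable_policy (g : team_policy) : Prop :=
  forall k, measurable_fun setT (g k : borel (Y k) -> borel (U k)).

Definition strat_map (g : team_policy) (w : MS) : XS :=
  (w.1, fun k => (w.2 k, g k (w.2 k))).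

Definition is_strategic (mu : probability (borel MS) R) (g : team_policy)
  (P : probability (borel XS) R) : Prop :=
  forall B : set (borel XS), measurable B -> P B = mu (strat_map g @^-1` B).

Definition L_A (mu : probability (borel MS) R) : set (weakP R XS) :=
  [set P | exists g, measurable_policy g /\ is_strategic mu g P].

Definition rect (A : set MS) (C : forall k, set (U k)) : set XS :=
  [set x | A (x.1, fun k => (x.2 k).1) /\ forall k, C k (x.2 k).2].

Definition L_R (mu : probability (borel MS) R) : set (weakP R XS) :=
  [set P | exists kappa : forall k, R.-pker borel (Y k) ~> borel (U k),
    forall (A : set (borel MS)) (C : forall k, set (borel (U k))),
      measurable A -> (forall k, measurable (C k)) ->
      P (rect A C) = (\int[mu]_(w in A) \prod_(k < n) kappa k (w.2 k) (C k))%E].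

Definition W : ptopologicalType := dprod (fun _ : 'I_n => R).
Definition unit_cube : set W := [set z | forall k, 0 <= z k <= 1].

Definition L_C (mu : probability (borel MS) R) : set (weakP R XS) :=
  [set P | exists (eta : probability (borel W) R) (g : W -> team_policy)
     (Q : W -> weakP R XS),
    eta unit_cube = 1%E /\
    (forall z, unit_cube z -> measurable_policy (g z) /\ is_strategic mu (g z) (Q z)) /\
    measurable_fun (unit_cube : set (borel W)) (Q : borel W -> borel (weakP R XS)) /\
    forall B : set (borel XS), measurable B ->
      P B = (\int[eta]_(z in unit_cube) Q z B)%E].
End team.

(* Main.v *)
(* [L_R] contains [L_A], and an element of [L_R] that is not in [L_A] is the midpoint
   of two distinct elements of [L_R]: if the kernel of agent [k] charges both [B] and
   its complement, tilt it to [kappa (. & B) + kappa (~ B) kappa (.)] or to the same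
   expression with [~ B].  [L_R] is not convex, but this is what Choquet's theorem
   needs.  The limit along an ultrafilter on [L_C] of the integrals of a test function
   is a linear functional dominated by the support function of the compact set [L_R].
   Extending it (Hahn-Banach) with the largest possible value at a strictly convex
   continuous function gives a representing measure on [L_R] that lives on the points
   which are not midpoints, hence on [L_A]; parametrised by Lebesgue measure on [0, 1],
   it exhibits the limit as an element of [L_C]. *)
Require Import Defs.
From HB Require Import structures.
From mathcomp Require Import all_boot all_order all_algebra.
From mathcomp Require Import all_classical all_reals all_analysis.
From mathcomp Require Import measurable_realfun.
From mathcomp Require Import ring lra.
Set Implicit Arguments. Unset Strict Implicit. Unset Printing Implicit Defensive.
Import Order.TTheory GRing.Theory Num.Theory.
Import numFieldNormedType.Exports.
Local Open Scope classical_set_scope.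
Local Open Scope ring_scope.

(** The Hahn-Banach functional lives on all bounded functions; on indicators it is just finitely
    additive, and no Riesz theorem turns it into a measure. The curve is built from it directly.
    Countably many sets cut the compact set into ever finer pieces, each piece owns an interval
    whose length is the value of the functional at its indicator, and a parameter is sent to a
    cluster point of the pieces it runs through. Riemann sums identify integrals along the curve
    with values of the functional. The weak topology need not be Hausdorff: two probabilities can
    agree on all measurable sets and differ as set functions. Hence functions, open sets and
    midpoints are handled through a countable family of integrals, which determines a probability on
    measurable sets. Separability supplies that family by means of a countable base of cozero sets,
    and the strictly convex function is a weighted sum of squares of its members. *)

(** * Hahn-Banach: linear minorants of sublinear functionals *)

Section hahn_banach.
Context {R : realType} {V : lmodType R}.
Variable S : set V.
Hypothesis SD : forall f g, S f -> S g -> S (f + g).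
Hypothesis SZ : forall (t : R) f, S f -> S (t *: f).
Implicit Types (p q : V -> R).

Definition sublinear_on q :=
  (forall f g, S f -> S g -> q (f + g) <= q f + q g) /\
  (forall t f, 0 <= t -> S f -> q (t *: f) = t * q f).

(** For [q] sublinear, this is the largest sublinear functional below [q] whose value at [- h] is at
    most [- q h]. *)
Let tilt q h g := inf [set q (g + t *: h) - t * q h | t in [set t | 0 <= t]].

Lemma sublinear_on0 q : sublinear_on q -> S 0 -> q 0 = 0.
Proof. by move=> [_ qZ] S0; rewrite -(scale0r 0) qZ ?mul0r. Qed.

Lemma sublinear_onN q g : sublinear_on q -> S g -> - q (- g) <= q g.
Proof.
move=> sq Sg.
have SN : S (- g) by rewrite -scaleN1r; exact: SZ.
have S0 : S 0 by rewrite -(subrr g); exact: SD.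
by rewrite lerNl -subr_ge0 opprK -(sublinear_on0 sq S0) -(addNr g) sq.1.
Qed.

Let tilt_lb q h g : sublinear_on q -> S h -> S g ->
  lbound [set q (g + t *: h) - t * q h | t in [set t | 0 <= t]] (- q (- g)).
Proof.
move=> sq Sh Sg _ [t t0 <-].
have SN : S (- g) by rewrite -scaleN1r; exact: SZ.
have := sq.1 (g + t *: h) (- g) (SD Sg (SZ _ Sh)) SN.
by rewrite addrAC subrr add0r sq.2// => H; lra.
Qed.

Let tilt_le q h g t : sublinear_on q -> S h -> S g -> 0 <= t ->
  tilt q h g <= q (g + t *: h) - t * q h.
Proof.
move=> sq Sh Sg t0; apply: ge_inf; last by exists t.
by exists (- q (- g)); exact: tilt_lb.
Qed.

Let tilt_ge q h g x : (forall t, 0 <= t -> x <= q (g + t *: h) - t * q h) ->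
  x <= tilt q h g.
Proof.
move=> H; apply: lb_le_inf; first by exists (q (g + 0 *: h) - 0 * q h); exists 0 => //=; exact: lexx.
by move=> _ [t /= t0 <-]; exact: H.
Qed.

Let tilt_sublinear q h : sublinear_on q -> S h -> sublinear_on (tilt q h).
Proof.
move=> sq Sh; split=> [f g Sf Sg|t f].
  rewrite -lerBlDr; apply: tilt_ge => s s0; rewrite lerBlDr -lerBlDl.
  apply: tilt_ge => t t0; rewrite lerBlDl.
  apply: (le_trans (tilt_le sq Sh (SD Sf Sg) (addr_ge0 s0 t0))).
  have := sq.1 _ _ (SD Sf (SZ s Sh)) (SD Sg (SZ t Sh)).
  by rewrite addrACA -scalerDl => H; lra.
rewrite le_eqVlt => /orP[/eqP<- Sf|t0 Sf].
  rewrite scale0r mul0r; apply/eqP; rewrite eq_le; apply/andP; split.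
    have S0 : S 0 by rewrite -(scale0r f); exact: SZ.
    apply: (le_trans (tilt_le sq Sh S0 (lexx 0))).
    by rewrite scale0r addr0 mul0r subr0 sublinear_on0.
  by apply: tilt_ge => s s0; rewrite add0r sq.2// subrr.
apply/eqP; rewrite eq_le; apply/andP; split.
  rewrite mulrC -ler_pdivrMr//; apply: tilt_ge => s s0.
  rewrite ler_pdivrMr//.
  apply: (le_trans (tilt_le sq Sh (SZ _ Sf) (mulr_ge0 (ltW t0) s0))).
  by rewrite -scalerA -scalerDr sq.2 ?(ltW t0)//; [lra | exact: SD _ (SZ _ _)].
apply: tilt_ge => s s0; rewrite mulrC -ler_pdivlMr//.
apply: (le_trans (tilt_le sq Sh Sf (divr_ge0 s0 (ltW t0)))).
rewrite ler_pdivlMr//.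
have -> : t *: f + s *: h = t *: (f + (s / t) *: h).
  by rewrite scalerDr scalerA mulrCA divff ?mulr1// gt_eqF.
rewrite sq.2 ?(ltW t0)//; last exact: SD _ (SZ _ _).
by rewrite mulrBl mulrAC divfK ?gt_eqF// (mulrC t).
Qed.

Let dominated p : Type := {q | sublinear_on q /\ forall g, S g -> q g <= p g}.

(** Comparing values on [S] alone gives a preorder, not an order, which is why Zorn's lemma is used
    in its preorder form. The order is reversed: a maximal element is a minimal functional. *)
Let below p (a b : dominated p) := `[< forall g, S g -> sval b g <= sval a g >].

(* Passing to the tilt at [h] gives a smaller functional with [q (- h) <= - q h]:
   a minimal sublinear functional is therefore linear. *)
Theorem linear_minorant p h : sublinear_on p -> S 0 -> S h ->
  exists l : V -> R, [/\ forall f g, S f -> S g -> l (f + g) = l f + l g,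
    forall t f, S f -> l (t *: f) = t * l f,
    forall g, S g -> l g <= p g & l h = p h].
Proof.
move=> sp S0 Sh.
have tilt_id q k g : sublinear_on q -> S k -> S g -> tilt q k g <= q g.
  move=> sq Sk Sg; apply: (le_trans (tilt_le sq Sk Sg (lexx 0))).
  by rewrite scale0r addr0 mul0r subr0.
have tiltN q k : sublinear_on q -> S k -> tilt q k (- k) <= - q k.
  move=> sq Sk; have SNk : S (- k) by rewrite -scaleN1r; exact: SZ.
  apply: (le_trans (tilt_le sq Sk SNk ler01)).
  by rewrite scale1r addNr mul1r sublinear_on0 // sub0r.
(* Zorn's lemma starts from the tilt of [p] at [h] and not from [p]: everything below it is at most
   [- p h] at [- h], so a linear functional found there is at least [p h] at [h]. *)
pose p' := tilt p h.
have sp' : sublinear_on p' by exact: tilt_sublinear.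
pose t0 : dominated p' := exist _ p' (conj sp' (fun g _ => lexx (p' g))).
have [||A Atot|[q [sq qp']] qmin] := @ZL_preorder (dominated p') t0 (@below p').
- by move=> q; apply/asboolP.
- move=> a b c /asboolP ab /asboolP bc; apply/asboolP => g Sg.
  exact: le_trans (bc _ Sg) (ab _ Sg).
- have [/set0P[a0 Aa0]|A0] := pselect (A != set0); last first.
    exists t0 => s As; exfalso; apply: A0; apply/set0P; by exists s.
  pose E g := [set sval a g | a in A].
  pose m g := inf (E g).
  have Elb g : S g -> has_lbound (E g).
    move=> Sg; exists (- p' (- g)) => _ [a Aa <-].
    have SN : S (- g) by rewrite -scaleN1r; exact: SZ.
    apply: le_trans (sublinear_onN (svalP a).1 Sg); rewrite lerN2.
    exact: (svalP a).2.
  have m_le a g : A a -> S g -> m g <= sval a g.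
    by move=> Aa Sg; apply: ge_inf; [exact: Elb|exists a].
  have m_ge g x : (forall a, A a -> x <= sval a g) -> x <= m g.
    move=> H; apply: lb_le_inf; first by exists (sval a0 g); exists a0.
    by move=> _ [a Aa <-]; exact: H.
  have sm : sublinear_on m.
    split=> [f g Sf Sg|t f].
      rewrite -lerBlDr; apply: (m_ge) => a Aa; rewrite lerBlDr -lerBlDl.
      apply: m_ge => b Ab; rewrite lerBlDl.
      (* The smaller of two members of the chain serves both arguments; this makes the infimum
         subadditive. *)
      case: (Atot _ _ Aa Ab) => /asboolP ab.
        apply: (le_trans (m_le _ _ Ab (SD Sf Sg))).
        apply: (le_trans ((svalP b).1.1 _ _ Sf Sg)).
        by rewrite lerD2r; exact: ab.
      apply: (le_trans (m_le _ _ Aa (SD Sf Sg))).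
      apply: (le_trans ((svalP a).1.1 _ _ Sf Sg)).
      by rewrite lerD2l; exact: ab.
    move=> t0' Sf; apply/eqP; rewrite eq_le; apply/andP; split.
      move: t0'; rewrite [0 <= t]le_eqVlt => /orP[/eqP<-|t0'].
        apply: le_trans (m_le a0 _ Aa0 (SZ _ Sf)) _.
        by rewrite (svalP a0).1.2// !mul0r.
      rewrite mulrC -ler_pdivrMr//; apply: m_ge => a Aa; rewrite ler_pdivrMr//.
      apply: le_trans (m_le a _ Aa (SZ _ Sf)) _.
      by rewrite (svalP a).1.2 ?(ltW t0')// mulrC.
    apply: m_ge => a Aa; rewrite (svalP a).1.2//; apply: ler_wpM2l => //.
    exact: m_le.
  have mp g : S g -> m g <= p' g.
    by move=> Sg; exact: le_trans (m_le a0 _ Aa0 Sg) ((svalP a0).2 _ Sg).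
  exists (exist _ m (conj sm mp)) => a Aa; apply/asboolP => g Sg /=; exact: m_le.
have minq k g : S k -> S g -> q g <= tilt q k g.
  move=> Sk Sg; have st := tilt_sublinear sq Sk.
  have tp g' : S g' -> tilt q k g' <= p' g'.
    by move=> Sg'; exact: le_trans (tilt_id _ _ _ sq Sk Sg') (qp' _ Sg').
  pose t : dominated p' := exist _ _ (conj st tp).
  suff /asboolP/(_ g Sg) : below t (exist _ q (conj sq qp')) by [].
  by apply: (qmin t); apply/asboolP => g' Sg' /=; exact: tilt_id.
have SN g : S g -> S (- g) by rewrite -scaleN1r; exact: SZ.
have qN g : S g -> q (- g) = - q g.
  move=> Sg; apply/eqP; rewrite eq_le; apply/andP; split.
    by apply: le_trans (minq _ _ Sg (SN _ Sg)) _; exact: tiltN.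
  by rewrite lerNl; exact: sublinear_onN.
exists q; split.
- move=> f g Sf Sg; apply/eqP; rewrite eq_le sq.1//=.
  have := sq.1 _ _ (SN _ Sf) (SN _ Sg).
  by rewrite -opprD !qN//; [lra|exact: SD].
- move=> t f Sf; have [t0'|t0'] := leP 0 t; first exact: sq.2.
  have -> : t *: f = - ((- t) *: f) by rewrite scaleNr opprK.
  rewrite qN; last exact: SZ.
  by rewrite sq.2 ?oppr_ge0 ?(ltW t0')// mulNr opprK.
- by move=> g Sg; exact: le_trans (qp' _ Sg) (tilt_id _ _ _ sp Sh Sg).
- apply/eqP; rewrite eq_le; apply/andP; split.
    exact: le_trans (qp' _ Sh) (tilt_id _ _ _ sp Sh Sh).
  have := le_trans (qp' _ (SN _ Sh)) (tiltN _ _ sp Sh).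
  by rewrite qN// lerN2.
Qed.

End hahn_banach.

(** * From a positive linear functional to intervals of the line *)

Section dyadic_walk.
Context {R : realType} {T : Type}.
Variables (K : set T) (l : (T -> R) -> R) (A : nat -> set T).

Definition bounded_over (f : T -> R) := exists M, forall x, K x -> `|f x| <= M.

Hypothesis lD : forall f g, bounded_over f -> bounded_over g ->
  l (f + g) = l f + l g.
Hypothesis lZ : forall t f, bounded_over f -> l (t *: f) = t * l f.
Hypothesis l_ge0 : forall f, bounded_over f -> (forall x, K x -> 0 <= f x) ->
  0 <= l f.

Lemma bounded_overD f g : bounded_over f -> bounded_over g -> bounded_over (f + g).
Proof.
move=> [M fM] [N gN]; exists (M + N) => x Kx.
by rewrite (le_trans (ler_normD _ _))// lerD ?fM ?gN.
Qed.

Lemma bounded_overZ t f : bounded_over f -> bounded_over (t *: f).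
Proof.
move=> [M fM]; exists (`|t| * M) => x Kx.
by rewrite normrM ler_wpM2l// fM.
Qed.

Lemma bounded_overM f g : bounded_over f -> bounded_over g ->
  bounded_over (fun x => f x * g x).
Proof.
move=> [M fM] [N gN]; exists (M * N) => x Kx.
by rewrite normrM ler_pM ?fM ?gN.
Qed.

Lemma bounded_over_cst c : bounded_over (fun=> c).
Proof. by exists `|c|. Qed.

Lemma bounded_over_indic s : bounded_over \1_s.
Proof. by exists 1 => x _; rewrite indicE; case: (_ \in _); rewrite ?normr1 ?normr0. Qed.

(** Finitely additive on all subsets of [T]; positivity and linearity of [l] give no more. *)
Definition mass s := l \1_s.

Lemma mass_ge0 s : 0 <= mass s.
Proof. by apply: l_ge0; [exact: bounded_over_indic|move=> x _; rewrite indicE]. Qed.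

Lemma le_functional f g : bounded_over f -> bounded_over g ->
  (forall x, K x -> f x <= g x) -> l f <= l g.
Proof.
move=> bf bg fg; rewrite -subr_ge0 -mulN1r -lZ// -lD//; last exact: bounded_overZ.
apply: l_ge0; first by apply: bounded_overD => //; exact: bounded_overZ.
by move=> x Kx; rewrite scaleN1r subr_ge0 fg.
Qed.

Lemma functional_norm_le f c s : bounded_over f ->
  (forall x, K x -> `|f x| <= c * \1_s x) -> `|l f| <= c * mass s.
Proof.
move=> bf fc; have bs : bounded_over (c *: \1_s : T -> R).
  by apply: bounded_overZ; exact: bounded_over_indic.
rewrite /mass -lZ; last exact: bounded_over_indic.
rewrite ler_norml -mulN1r -lZ//; apply/andP; split.
  apply: le_functional => // [|x Kx]; first exact: bounded_overZ.
  by rewrite scaleN1r; have := fc x Kx; rewrite ler_norml => /andP[].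
apply: le_functional => // x Kx.
by have := fc x Kx; rewrite ler_norml => /andP[].
Qed.

Lemma functional_split f s u : bounded_over f ->
  l (fun x => f x * \1_s x) = l (fun x => f x * \1_(s `&` ~` u) x) +
                              l (fun x => f x * \1_(s `&` u) x).
Proof.
move=> bf; rewrite -lD; try by apply: bounded_overM => //; exact: bounded_over_indic.
congr l; apply/funext => x; rewrite /GRing.add /= -mulrDr; congr (_ * _).
rewrite !indicE !in_setI in_setC.
by case: (x \in s); case: (x \in u); rewrite /= ?addr0 ?add0r.
Qed.

Lemma mass_split s u : mass s = mass (s `&` ~` u) + mass (s `&` u).
Proof.
have E v : \1_v = (fun x => 1 * \1_v x) :> (T -> R).
  by apply/funext => x; rewrite mul1r.
by rewrite /mass (E s) (functional_split s u (bounded_over_cst 1)) -!E.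
Qed.

(* A state [(s, a)] stands for the piece [s] sitting on the interval
   [[a, a + mass s[]; a step cuts it along [A j]. *)
Definition step j (t : R) (sa : set T * R) : set T * R :=
  let b := sa.2 + mass (sa.1 `&` ~` A j) in
  if t < b then (sa.1 `&` ~` A j, sa.2) else (sa.1 `&` A j, b).

Fixpoint walk m j (t : R) (sa : set T * R) : set T * R :=
  if m is m'.+1 then walk m' j.+1 t (step j t sa) else sa.

(** Half-open, so that the spans of the two halves of a piece partition its span and a piece of mass
    zero has an empty span. *)
Definition span (sa : set T * R) : set R := `[sa.2, sa.2 + mass sa.1[.

(** [walk] unfolds at its first cut, which suits the splitting of integrals; the nesting of pieces
    needs the last cut, peeled off here. *)
Lemma walkS m j t sa : walk m.+1 j t sa = step (j + m) t (walk m j t sa).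
Proof.
elim: m j sa => [|m IH] j sa; first by rewrite /= addn0.
by rewrite addnS -addSn -IH.
Qed.

Lemma step_span j t sa : span sa t -> span (step j t sa) t.
Proof.
rewrite /span /step /= !in_itv /= => /andP[at_ tb].
case: ltP => tc /=; first by rewrite at_.
by rewrite tc -addrA -mass_split.
Qed.

Lemma walk_span m j t sa : span sa t -> span (walk m j t sa) t.
Proof. by elim: m j sa => //= m IH j sa H; apply: IH; exact: step_span. Qed.

Lemma step_sub j t sa : (step j t sa).1 `<=` sa.1.
Proof. by rewrite /step; case: ifP => _ x []. Qed.

Lemma walk_subS m t sa : (walk m.+1 0 t sa).1 `<=` (walk m 0 t sa).1.
Proof. by rewrite walkS; exact: step_sub. Qed.

Lemma walk_sub m m' t sa : (m <= m')%N ->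
  (walk m' 0 t sa).1 `<=` (walk m 0 t sa).1.
Proof.
elim: m' => [|m' IH]; first by rewrite leqn0 => /eqP->.
rewrite leq_eqVlt => /orP[/eqP->//|/IH H]; exact: subset_trans (@walk_subS _ _ _) H.
Qed.

(** Step [i] keeps one side of [A i] and later steps only shrink the piece. Exchanging [x] and [y]
    gives the converse implication. *)
Lemma walk_agree m t sa i x y : (i < m)%N ->
  (walk m 0 t sa).1 x -> (walk m 0 t sa).1 y -> A i x -> A i y.
Proof.
elim: m => // m IH; rewrite ltnS leq_eqVlt => /orP[/eqP->|im].
  by rewrite walkS add0n /step; case: ifP => _ /= [_ Ax] [_ Ay].
by move=> /walk_subS wx /walk_subS wy; exact: IH.
Qed.

(** A point in the span forces positive mass, whereas an indicator vanishing on [K] has mass zero by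
    positivity. *)
Lemma span_inhabited t sa : span sa t -> exists2 x, K x & sa.1 x.
Proof.
rewrite /span /= in_itv /= => /andP[/le_lt_trans H /H{H}]; rewrite ltrDl => m0.
apply: contrapT => /forall2NP H.
suff : `|l \1_(sa.1)| <= 0 * mass sa.1.
  by rewrite mul0r normr_le0 => /eqP E; move: m0; rewrite /mass E ltxx.
apply: functional_norm_le => [|x Kx]; first exact: bounded_over_indic.
rewrite mul0r indicE memNset ?normr0// => sx.
by case: (H x).
Qed.

Local Notation leb := (@lebesgue_measure R).

(** The integrand is a step function: a final piece [s] contributes [v s * mass s], which differs
    from the value of [l] at [h] cut down to [s] by at most [e * mass s]. The integral is thus a
    Riemann sum for [l]. *)
Lemma walk_integral m j sa (v : set T -> R) h (e : R) : bounded_over h ->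
  (forall t x, span sa t -> K x -> (walk m j t sa).1 x ->
    `|h x - v (walk m j t sa).1| <= e) ->
  measurable_fun (span sa) (fun t => v (walk m j t sa).1) /\
  exists2 r : R, (\int[leb]_(t in span sa) (v (walk m j t sa).1)%:E)%E = r%:E &
    `|r - l (fun x => h x * \1_(sa.1) x)| <= e * mass sa.1.
Proof.
move=> bh; elim: m j sa => [|m IH] j sa he /=.
  split; first exact: measurable_cst.
  exists (v sa.1 * mass sa.1).
    rewrite (integral_cst leb) /span; last exact: measurable_itv.
    rewrite /= lebesgue_measure_itv /= lte_fin ltrDl EFinM; congr (_ * _)%E.
    have := mass_ge0 sa.1; rewrite le_eqVlt => /orP[/eqP<-|->].
      by rewrite ltxx.
    by rewrite -EFinB addrAC subrr add0r.
  have bs := @bounded_over_indic sa.1.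
  have -> : v sa.1 * mass sa.1 - l (fun x => h x * \1_(sa.1) x) =
      l (fun x => (v sa.1 - h x) * \1_(sa.1) x).
    rewrite /mass -lZ// -mulN1r -lZ; last exact: bounded_overM.
    rewrite -lD; [|exact: bounded_overZ|]; last first.
      by apply: bounded_overZ; exact: bounded_overM.
    congr l; apply/funext => x; rewrite mulrBl.
    by rewrite -[in RHS]mulN1r.
  have bvh : bounded_over (fun x => (v sa.1 - h x) * \1_(sa.1) x).
    apply: bounded_overM => //.
    have -> : (fun x => v sa.1 - h x) = (fun=> v sa.1) + (-1) *: h.
      by apply/funext => x; rewrite scaleN1r.
    by apply: bounded_overD; [exact: bounded_over_cst|exact: bounded_overZ].
  (* When the mass is zero the span is empty and [he] gives nothing; the crude bound [|v| + M] times
     zero is enough. *)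
  have := mass_ge0 sa.1; rewrite le_eqVlt => /orP[/eqP m0|m0].
    have [M hM] := bh.
    rewrite -m0 mulr0 -[leRHS](mulr0 (`|v sa.1| + M)) m0.
    apply: functional_norm_le => // x Kx.
    rewrite normrM indicE; case: (_ \in _); rewrite ?normr1 ?normr0 ?mulr0//.
    by rewrite !mulr1 (le_trans (ler_normB _ _))// lerD2l hM.
  apply: functional_norm_le => // x Kx.
  rewrite indicE; case: (boolP (x \in sa.1)); last by move=> _; rewrite !mulr0 normr0.
  rewrite !mulr1 inE => sx; rewrite distrC; apply: (he sa.2) => //.
  by rewrite /span /= in_itv /= lexx ltrDl.
set s0 := (sa.1 `&` ~` A j, sa.2).
set s1 := (sa.1 `&` A j, sa.2 + mass (sa.1 `&` ~` A j)).
have spanE : span sa = span s0 `|` span s1.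
  apply/seteqP; split=> t; rewrite /span /= !in_itv /=.
    by move=> /andP[-> tb]; case: (ltP t) => H; [left|right; rewrite -addrA -mass_split tb].
  move=> [|] /andP[a1 a2].
    by rewrite a1 (lt_le_trans a2)//= lerD2l (mass_split sa.1 (A j)) lerDl mass_ge0.
  rewrite (le_trans _ a1) ?lerDl ?mass_ge0//=.
  by move: a2; rewrite -addrA -mass_split.
have step0 t : span s0 t -> step j t sa = s0.
  by rewrite /span /= in_itv /= /step => /andP[_ ->].
have step1 t : span s1 t -> step j t sa = s1.
  by rewrite /span /= in_itv /= /step => /andP[a1 _]; rewrite ltNge a1.
have [m0 [r0 i0 h0]] := IH j.+1 s0 (fun t x s0t Kx wx =>
  ltac:(have := he t x; rewrite /= step0//; apply => //; rewrite spanE; by left)).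
have [m1 [r1 i1 h1]] := IH j.+1 s1 (fun t x s1t Kx wx =>
  ltac:(have := he t x; rewrite /= step1//; apply => //; rewrite spanE; by right)).
have mv0 : measurable_fun (span s0) (fun t => v (walk m j.+1 t (step j t sa)).1).
  by apply: eq_measurable_fun m0 => t; rewrite inE => /step0->.
have mv1 : measurable_fun (span s1) (fun t => v (walk m j.+1 t (step j t sa)).1).
  by apply: eq_measurable_fun m1 => t; rewrite inE => /step1->.
have mspan u : measurable (span u) by exact: measurable_itv.
have mv : measurable_fun (span sa) (fun t => v (walk m j.+1 t (step j t sa)).1).
  by rewrite spanE; apply/measurable_funU.
split => //; exists (r0 + r1).
  have dis : [disjoint span s0 & span s1].
    apply/disj_setPS => t []; rewrite /span /= !in_itv /= => /andP[_ a1] /andP[a2 _].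
    by have := lt_le_trans a1 a2; rewrite ltxx.
  have mE : measurable_fun (span s0 `|` span s1)
      (EFin \o (fun t => v (walk m j.+1 t (step j t sa)).1)).
    by rewrite -spanE; exact/measurable_EFinP.
  rewrite spanE (integral_setU leb) //; try exact: mspan.
  rewrite EFinD -i0 -i1; congr (_ + _)%E; apply: eq_integral => t; rewrite inE.
    by move=> /step0->.
  by move=> /step1->.
rewrite (functional_split sa.1 (A j) bh) (mass_split sa.1 (A j)).
rewrite mulrDr opprD addrACA; apply: le_trans (ler_normD _ _) _; exact: lerD.
Qed.

End dyadic_walk.

(** * Countable families of continuous functions on a compact set *)

Section separating_family.
Context {R : realType} {T : topologicalType}.
Variables (K : set T) (f : nat -> T -> R).
Hypothesis cK : compact K.
Hypothesis fc : forall i, continuous (f i).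
Hypothesis f1 : forall i x, `|f i x| <= 1.

(** Stands in for the separation of points, which cannot be asked of [weakP]: on [K] the function
    factors through the values of the family. *)
Definition respects_family (h : T -> R) := forall x y, K x -> K y ->
  (forall i, f i x = f i y) -> h x = h y.

(** Superlevel sets at rational heights, enumerated by [pickle]; a number that codes nothing yields
    [set0], a cut without effect. *)
Definition cut (j : nat) : set T :=
  if unpickle j is Some (i, q) then [set x | ratr q < f i x] else set0.

Lemma cutE i (q : rat) : cut (pickle (i, q)) = [set x | ratr q < f i x].
Proof. by rewrite /cut pickleK. Qed.

Lemma bounded_over_continuous (h : T -> R) : continuous h -> bounded_over K h.
Proof.
move=> hc; have /compact_bounded[M [_ HM]] : compact (h @` K).
  by apply: continuous_compact => //; exact: continuous_subspaceT.
exists (M + 1) => x Kx; apply: (HM (M + 1)); first by rewrite ltrDl.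
by exists x.
Qed.

(** By compactness of the square of [K], counterexamples for every [m] would cluster at some pair.
    Were the two points told apart by some [f i], a rational strictly between the values would give
    a cut that separates nearby pairs; so they share all values of the family, and [h] agrees on
    them. *)
Lemma cuts_control_oscillation (h : T -> R) (e : R) : continuous h -> respects_family h -> 0 < e ->
  exists m, forall x y, K x -> K y ->
    (forall j, (j < m)%N -> cut j x <-> cut j y) -> `|h x - h y| <= e.
Proof.
move=> hc hr e0; apply: contrapT => /forallNP H.
have {H} H m : exists p : T * T, [/\ K p.1, K p.2,
    (forall j, (j < m)%N -> cut j p.1 <-> cut j p.2) & e < `|h p.1 - h p.2|].
  apply: contrapT => /forallNP Hm; apply: (H m) => x y Kx Ky xy.
  by rewrite leNgt; apply/negP => exy; apply: (Hm (x, y)).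
have [u uP] := choice H.
have [] := @compact_setX _ _ K K cK cK (u @ \oo) _ _.
  by exists 0%N => // m _; have [] := uP m.
move=> [x y] [[/= Kx Ky] xy].
have often (B : set (T * T)) N : nbhs (x, y) B -> exists2 m, (N <= m)%N & B (u m).
  move=> nB; have [|_ [[m /= Nm <-]]] := xy (u @` [set m | (N <= m)%N]) B _ nB.
    by exists N => // m /= Nm; exists m.
  by exists m.
(* The disjunct with swapped components lets one argument serve both [f i x < f i y] and the
   reverse. *)
have lt_case a b i q : K a -> K b -> (forall B N, nbhs (a, b) B ->
    exists2 m, (N <= m)%N & B (u m) \/ B ((u m).2, (u m).1)) ->
    f i a < ratr q -> ratr q < f i b -> False.
  move=> Ka Kb ab aq qb.
  have [|m Nm] := ab ([set z | f i z < ratr q] `*` [set z | ratr q < f i z])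
      (pickle (i, q)).+1.
  - exists ([set z | f i z < ratr q], [set z | ratr q < f i z]) => //; split.
      exact: (cvgr_lt _ (@fc i a)).
    exact: (cvgr_gt _ (@fc i b)).
  have [_ _ /(_ _ Nm)] := uP m; rewrite cutE /= => um _.
  move=> [[/= u1 u2]|[/= u1 u2]].
    by have := lt_trans (um.2 u2) u1; rewrite ltxx.
  by have := lt_trans (um.1 u2) u1; rewrite ltxx.
have fxy i : f i x = f i y.
  apply/eqP; rewrite eq_le !leNgt; apply/andP; split; apply/negP.
    move=> /rat_in_itvoo[q]; rewrite in_itv /= => /andP[yq qx].
    apply: (lt_case y x i q) => // B N [[B1 B2] /= [nB1 nB2] B12].
    have [|m Nm [/= b2 b1]] := often (B2 `*` B1) N; first by exists (B2, B1).
    by exists m => //; right; apply: B12.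
  move=> /rat_in_itvoo[q]; rewrite in_itv /= => /andP[xq qy].
  apply: (lt_case x y i q) => // B N nB.
  by have [m Nm um] := often B N nB; exists m => //; left.
have hxy := hr _ _ Kx Ky fxy.
have [|m _ [/= h1 h2]] := often ([set z | `|h x - h z| < e / 2] `*`
    [set z | `|h y - h z| < e / 2]) 0%N.
- exists ([set z | `|h x - h z| < e / 2], [set z | `|h y - h z| < e / 2]) => //=.
  by split; move/cvgrPdist_lt : (hc x) (hc y) => /(_ _) H1 /cvgrPdist_lt H2;
    [apply: H1|apply: H2]; rewrite divr_gt0.
have [_ _ _] := uP m; rewrite ltNge => /negP; apply.
have -> : h (u m).1 - h (u m).2 = (h y - h (u m).2) - (h x - h (u m).1).
  by rewrite hxy; ring.
apply: le_trans (ler_normB _ _) _.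
by rewrite (splitr e) lerD// ltW.
Qed.

Let weight n : R := 2^-1 ^+ n.

Let weight_gt0 n : 0 < weight n.
Proof. by rewrite /weight exprn_gt0// invr_gt0. Qed.

Let energy_ n x := \sum_(i < n) weight i.+1 * f i x ^+ 2.

(** The sum of the series [2^-(i+1) * f i x ^+ 2], as a supremum of increasing partial sums. The
    shift in the weights makes the tail after [n] terms at most [weight n]. *)
Definition energy x := sup (range (energy_^~ x)).

Let sq_le1 i x : f i x ^+ 2 <= 1.
Proof. by rewrite -real_normK ?num_real// expr_le1. Qed.

Let energy_nd n m x : (n <= m)%N -> energy_ n x <= energy_ m x.
Proof.
move=> /subnK<-; elim: (m - n)%N => [|k IH]; first by rewrite add0n.
rewrite addSn (le_trans IH)// {2}/energy_ big_ord_recr /= lerDl mulr_ge0//.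
  exact/ltW/weight_gt0.
exact: sqr_ge0.
Qed.

Let energy_tail n m x : energy_ m x <= energy_ n x + weight n.
Proof.
have [mn|/ltnW nm] := leqP m n.
  by rewrite (le_trans (energy_nd x mn))// lerDl ltW.
(* This sum is nonincreasing in [m]: a new term is at most its weight, and [weight m] is twice
   [weight m.+1]. *)
suff : energy_ m x + weight m <= energy_ n x + weight n.
  by apply: le_trans; rewrite lerDl ltW.
rewrite -(subnK nm); elim: (m - n)%N => [|k IH]; first by rewrite add0n.
apply: le_trans IH; rewrite addSn {1}/energy_ big_ord_recr /= -addrA lerD2l.
have -> : weight (k + n) = weight (k + n).+1 + weight (k + n).+1.
  by rewrite /weight exprS; field.
by rewrite lerD2r ler_piMr// ltW.
Qed.

Let energy_sup x : has_sup (range (energy_^~ x)).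
Proof.
split; first by exists (energy_ 0 x); exists 0%N.
by exists (energy_ 0 x + weight 0) => _ [m _ <-]; exact: energy_tail.
Qed.

Let energy_ge n x : energy_ n x <= energy x.
Proof. by apply: ub_le_sup; [have [] := energy_sup x|exists n]. Qed.

Let energy_le n x : energy x <= energy_ n x + weight n.
Proof.
apply: ge_sup; first by have [] := energy_sup x.
by move=> _ [m _ <-]; exact: energy_tail.
Qed.

Let weight_small e : 0 < e -> exists n, weight n < e.
Proof.
move=> e0; have := @cvg_expr R 2^-1 _.
rewrite ger0_norm ?invr_ge0// invf_lt1// ltr1n => /(_ isT)/cvgrPdist_lt/(_ e e0).
move=> [N _ /(_ N (leqnn _))] /=; rewrite sub0r normrN ger0_norm; last exact/ltW/weight_gt0.
by exists N.
Qed.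

Lemma energy_continuous : continuous energy.
Proof.
move=> x; apply/cvgrPdist_lt => e e0.
have e4 : 0 < e / 3 by rewrite divr_gt0.
have [n nw] := weight_small e4.
have /cvgrPdist_lt/(_ _ e4) : energy_ n y @[y --> x] --> energy_ n x.
  elim: (n) => [|k IH].
    have -> : energy_ 0 = cst 0 by apply/funext => y; rewrite /energy_ big_ord0.
    exact: cvg_cst.
  have -> : energy_ k.+1 = energy_ k \+ (fun y => weight k.+1 * (f k y * f k y)).
    by apply/funext => y; rewrite /energy_ big_ord_recr.
  apply: cvgD => //; apply: cvgM; first exact: cvg_cst.
  by apply: cvgM; exact: fc.
apply: filterS => y xy.
have := energy_ge n x; have := energy_le n x.
have := energy_ge n y; have := energy_le n y.
move: xy; rewrite !ltr_norml => /andP[]; move: nw; lra.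
Qed.

Lemma energy_respects : respects_family energy.
Proof.
move=> x y Kx Ky xy; congr sup; apply/funext => z; congr (exists2 n, _ & _ = z).
apply/funext => n; apply: eq_bigr => i _; by rewrite xy.
Qed.

Lemma energy_strictly_convex z x y : (forall i, f i z = (f i x + f i y) / 2) ->
  (energy x + energy y) / 2 <= energy z -> forall i, f i x = f i y.
Proof.
move=> zxy le_z i; apply/eqP; rewrite -subr_eq0 -sqrf_eq0 eq_le sqr_ge0 andbT.
rewrite leNgt; apply/negP => d0.
(* The square of a midpoint is the mean of the squares minus a quarter of the squared difference;
   [d] is this deficit in the term of index [i], and the other terms are convex. *)
pose d := weight i.+1 * ((f i x - f i y) ^+ 2 / 4).
have d_gt0 : 0 < d by rewrite mulr_gt0// divr_gt0.
have part n : (i < n)%N -> energy_ n z + d <= (energy_ n x + energy_ n y) / 2.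
  move=> im; rewrite /energy_ -big_split/= mulr_suml.
  rewrite (bigD1 (Ordinal im))//= [leRHS](bigD1 (Ordinal im))//= addrAC.
  apply: lerD; last first.
    apply: ler_sum => j _; rewrite -mulrDr -mulrA ler_wpM2l ?(ltW (weight_gt0 _))//.
    rewrite zxy; have := sqr_ge0 (f j x - f j y); lra.
  rewrite /d -mulrDr -mulrDr -mulrA ler_wpM2l ?(ltW (weight_gt0 _))//.
  by rewrite zxy; lra.
suff : energy z <= (energy x + energy y) / 2 - d by move: le_z d_gt0; lra.
apply: ge_sup; first by have [] := energy_sup z.
move=> _ [n _ <-].
have := part _ (leq_maxl i.+1 n).
have := energy_nd z (leq_maxr i.+1 n).
have := energy_ge (maxn i.+1 n) x; have := energy_ge (maxn i.+1 n) y; lra.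
Qed.

End separating_family.

(** * Choquet's theorem over a compact set without convexity *)

Section choquet.
Context {R : realType} {T : topologicalType}.
Variables (K : set T) (D : set (T -> R)) (L : (T -> R) -> R) (f : nat -> T -> R).
Hypothesis cK : compact K.
Hypothesis D_cst : forall c, D (fun=> c).
Hypothesis DD : forall g h, D g -> D h -> D (g + h).
Hypothesis DZ : forall c h, D h -> D (c *: h).
Hypothesis D_continuous : forall h, D h -> continuous h.
Hypothesis LD : forall g h, D g -> D h -> L (g + h) = L g + L h.
Hypothesis LZ : forall c h, D h -> L (c *: h) = c * L h.
Hypothesis L_le : forall h c, D h -> (forall x, K x -> h x <= c) -> L h <= c.
Hypothesis fD : forall i, D (f i).
Hypothesis f1 : forall i x, `|f i x| <= 1.
Hypothesis D_respects : forall h, D h -> respects_family K f h.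

Let L_ge h c : D h -> (forall x, K x -> c <= h x) -> c <= L h.
Proof.
move=> Dh ch; rewrite -lerN2 -mulN1r -LZ//; apply: L_le; first exact: DZ.
by move=> x Kx; rewrite scaleN1r lerN2 ch.
Qed.

Let L_cst c : L (fun=> c) = c.
Proof. by apply/eqP; rewrite eq_le L_le// L_ge. Qed.

Let majorants g := [set h | D h /\ forall x, K x -> g x <= h x].
(** [D] plays the part of the affine functions and [L] that of the barycentre, so this is the upper
    envelope of [g] at the barycentre. *)
Let upper g := inf [set L h | h in majorants g].

Let upper_has_inf g : bounded_over K g -> has_inf [set L h | h in majorants g].
Proof.
move=> [M gM]; split.
  exists (L (fun=> M)), (fun=> M) => //; split => // x Kx.
  by have := gM _ Kx; rewrite ler_norml => /andP[].
exists (- M) => _ [h [Dh gh] <-]; apply: L_ge => // x Kx.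
by apply: le_trans (gh _ Kx); have := gM _ Kx; rewrite ler_norml => /andP[].
Qed.

Let upper_le g h : bounded_over K g -> D h -> (forall x, K x -> g x <= h x) ->
  upper g <= L h.
Proof.
move=> bg Dh gh; apply: ge_inf; first by have [] := upper_has_inf bg.
by exists h.
Qed.

Let upper_ge g c : bounded_over K g ->
  (forall h, D h -> (forall x, K x -> g x <= h x) -> c <= L h) -> c <= upper g.
Proof.
move=> bg H; apply: lb_le_inf; first by have [] := upper_has_inf bg.
by move=> _ [h [Dh gh] <-]; exact: H.
Qed.

Let upper_sublinear : sublinear_on (bounded_over K) upper.
Proof.
split=> [g h bg bh|t g].
  have bgh := bounded_overD bg bh.
  rewrite -lerBlDr; apply: upper_ge => // g' Dg' gg'; rewrite lerBlDr -lerBlDl.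
  apply: upper_ge => // h' Dh' hh'; rewrite lerBlDl -LD//.
  by apply: upper_le => //; [exact: DD|move=> x Kx; apply: lerD; auto].
have E0 : upper (0 *: g) = 0.
  have b0 : bounded_over K (0 *: g : T -> R) by exists 0 => x _; rewrite scale0r normr0.
  apply/eqP; rewrite eq_le; apply/andP; split.
    by rewrite -[leRHS](L_cst 0); apply: upper_le => // x _; rewrite scale0r.
  apply: upper_ge => // h Dh h0; apply: L_ge => // x Kx.
  by have := h0 _ Kx; rewrite scale0r.
rewrite le_eqVlt => /orP[/eqP<- _|t0 bg]; first by rewrite E0 mul0r.
have btg := bounded_overZ t bg.
apply/eqP; rewrite eq_le; apply/andP; split.
  rewrite mulrC -ler_pdivrMr//; apply: upper_ge => // h Dh gh.
  rewrite ler_pdivrMr// mulrC -LZ//; apply: upper_le => //; first exact: DZ.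
  by move=> x Kx; rewrite ler_wpM2l ?gh// ltW.
apply: upper_ge => // h Dh gh; rewrite mulrC -ler_pdivlMr// mulrC -LZ//.
apply: upper_le => //; first exact: DZ.
move=> x Kx; rewrite -[leRHS]/(t^-1 * h x) ler_pdivlMl//; exact: gh.
Qed.

Local Notation I01 := (`[0%R, 1%R[%classic : set (measurableTypeR R)).
Local Notation leb := (@lebesgue_measure R).

(* [Psi] pushes Lebesgue measure to a maximal representing measure of [L]. *)
Theorem choquet : exists Psi : R -> T,
  [/\ forall t, I01 t -> K (Psi t),
      forall h, D h -> measurable_fun I01 (h \o Psi) /\
        (\int[leb]_(t in I01) (h (Psi t))%:E)%E = (L h)%:E &
      {ae leb, forall t, I01 t -> forall x y, K x -> K y ->
        (forall h, D h -> h (Psi t) = (h x + h y) / 2) ->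
        forall h, D h -> h x = h y}].
Proof.
have fc i : continuous (f i) by exact/D_continuous/fD.
have bD h : D h -> bounded_over K h.
  by move=> Dh; apply: bounded_over_continuous => //; exact: D_continuous.
pose phi := energy f.
have phic : continuous phi by exact: energy_continuous.
have bphi : bounded_over K phi by exact: bounded_over_continuous.
have [//|||l [lD lZ l_le l_phi]] := linear_minorant _ _ upper_sublinear _ bphi.
- by move=> g h; exact: bounded_overD.
- by move=> t g; exact: bounded_overZ.
- by exists 0 => x _; rewrite normr0.
have lL h : D h -> l h = L h.
  move=> Dh; have le1 g : D g -> l g <= L g.
    by move=> Dg; apply: le_trans (l_le _ (bD _ Dg)) _; apply: upper_le; auto.
  apply/eqP; rewrite eq_le le1//=.
  by have := le1 _ (DZ (-1) Dh); rewrite lZ ?LZ ?mulN1r ?lerN2//; exact: bD.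
have l_ge0 g : bounded_over K g -> (forall x, K x -> 0 <= g x) -> 0 <= l g.
  move=> bg g0; have bNg := bounded_overZ (-1) bg.
  rewrite -oppr_le0 -mulN1r -lZ//; apply: le_trans (l_le _ bNg) _.
  rewrite -(L_cst 0); apply: upper_le => // x Kx.
  by rewrite scaleN1r oppr_le0 g0.
pose A := cut f.
have mT : mass l setT = 1.
  by rewrite /mass indicT lL; [exact: L_cst|exact: D_cst].
pose w m t := (walk l A m 0 t (setT, 0)).1.
have spanT : span l (setT, 0) = I01 by rewrite /span /= mT add0r.
have wne m t : I01 t -> exists2 x, K x & w m t x.
  by rewrite -spanT => H; exact: (span_inhabited lD lZ l_ge0 (walk_span A lD m 0 H)).
(* The pieces met at [t] are nested and meet [K], but they need not be closed: a cluster point takes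
   the place of a common point. *)
have psi t : exists p, I01 t -> K p /\
    forall m B, nbhs p B -> exists x, [/\ K x, w m t x & B x].
  have [t01|nt01] := pselect (I01 t); last first.
    have [x _ _] := wne 0%N 0 (ltac:(by rewrite /= in_itv /= lexx ltr01)).
    by exists x.
  pose F := filter_from [set: nat] (fun m => K `&` w m t).
  have FF : ProperFilter F.
    apply: filter_from_proper; last first.
      by move=> m _; have [x Kx wx] := wne m t t01; exists x.
    apply: filter_from_filter; first by exists 0%N.
    move=> i j _ _; exists (maxn i j) => // x [Kx wx].
    by split; split=> //; apply: walk_sub wx; rewrite ?leq_maxl ?leq_maxr.
  have [|p [Kp clp]] := cK FF; first by exists 0%N => // x [].
  exists p => _; split=> // m B nB.
  have [|x [[Kx wx] Bx]] := clp (K `&` w m t) B _ nB; first by exists m.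
  by exists x.
have [Psi PsiP] := choice psi.
(* A piece of depth [m] controls [h] also at [Psi t], although [Psi t] may lie outside it, because
   points of the piece come arbitrarily near. *)
have osc (h : T -> R) (e : R) : continuous h -> respects_family K f h -> 0 < e ->
    exists m, forall t x, I01 t -> K x -> w m t x ->
    `|h (Psi t) - h x| <= e /\ (forall y, K y -> w m t y -> `|h y - h x| <= e).
  move=> hc hr e0; have e2 : 0 < e / 2 by rewrite divr_gt0.
  have [m mP] := cuts_control_oscillation cK fc hc hr e2.
  exists m => t x t01 Kx wx.
  have close y : K y -> w m t y -> `|h y - h x| <= e / 2.
    by move=> Ky wy; apply: mP => // j jm; split; exact: (@walk_agree _ _ l A m t (setT, 0)).
  split; last by move=> y Ky wy; apply: le_trans (close _ Ky wy) _; lra.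
  have [_ cl] := PsiP t t01.
  have [|y [Ky wy /= hy]] := cl m [set y | `|h (Psi t) - h y| < e / 2].
    by move/cvgrPdist_lt : (hc (Psi t)); apply.
  have -> : h (Psi t) - h x = (h (Psi t) - h y) + (h y - h x) by ring.
  apply: le_trans (ler_normD _ _) _.
  by rewrite (splitr e); apply: lerD; [exact: ltW|exact: close].
(* The sample value depends on the piece alone and not on [t], so that it is constant on the
   interval of that piece. *)
have pick_value (h : T -> R) : exists v : set T -> R, forall s x, K x -> s x ->
    exists y, [/\ K y, s y & v s = h y].
  have /choice[v vP] : forall s : set T, exists r : R, forall x, K x -> s x ->
      exists y, [/\ K y, s y & r = h y].
    move=> s; have [[x [Kx sx]]|ns] := pselect (exists x, K x /\ s x).
      by exists (h x) => _ _ _; exists x.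
    by exists 0 => x Kx sx; exfalso; apply: ns; exists x.
  by exists v.
have m01 : measurable I01 by exact: measurable_itv.
have leb01 : leb I01 = 1%E by rewrite /= lebesgue_measure_itv /= lte_fin ltr01 oppr0 adde0.
have leb_fin : (leb I01 < +oo)%E by rewrite leb01 ltry.
(* Not restricted to [D]: it is applied to the differences [g n - phi] as well. *)
have intPsi (h : T -> R) : continuous h -> respects_family K f h ->
    measurable_fun I01 (h \o Psi) /\
    (\int[leb]_(t in I01) (h (Psi t))%:E)%E = (l h)%:E.
  move=> hc hr; have [v vP] := pick_value h.
  have bh : bounded_over K h by exact: bounded_over_continuous.
  have approx (e : R) : 0 < e -> exists (g : R -> R) (r : R), [/\ measurable_fun I01 g,
      forall t, I01 t -> `|h (Psi t) - g t| <= e,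
      (\int[leb]_(t in I01) (g t)%:E)%E = r%:E & `|r - l h| <= e].
    move=> e0; have [m mP] := osc _ _ hc hr e0.
    have vh t x : span l (setT, 0) t -> K x -> w m t x -> `|h x - v (w m t)| <= e.
      rewrite spanT => t01 Kx wx; have [y [Ky wy ->]] := vP _ _ Kx wx.
      by have [_] := mP t y t01 Ky wy; apply.
    have [|mv [r ri rh]] := walk_integral lD lZ l_ge0 bh (v := v) (e := e) (sa := (setT, 0))
      (m := m) (j := 0%N) (A := A) _.
      exact: vh.
    exists (fun t => v (w m t)), r; rewrite -spanT; split => //.
      move=> t; rewrite spanT => t01; have [x Kx wx] := wne m t t01.
      have [y [Ky wy ->]] := vP _ _ Kx wx.
      by have [] := mP t y t01 Ky wy.
    move: rh; rewrite /= mT mulr1.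
    suff -> : (fun x => h x * \1_[set: T] x) = h by [].
    by apply/funext => x; rewrite indicT mulr1.
  have mh : measurable_fun I01 (h \o Psi).
    have /choice[g gP] : forall k : nat, exists g : R -> R, measurable_fun I01 g /\
        forall t, I01 t -> `|h (Psi t) - g t| <= k.+1%:R^-1.
      by move=> k; have [|g [r [mg hg _ _]]] := approx k.+1%:R^-1; last exists g.
    apply: (@measurable_fun_cvg _ _ _ _ g) => [k|t t01]; first by have [] := gP k.
    apply/cvgrPdist_le => e e0; near=> k.
    have [_ /(_ _ t01)/le_trans] := gP k; apply.
    by apply: ltW; near: k; exact: near_infty_natSinv_lt (PosNum e0).
  split => //.
  have [M hM] := bh.
  have ih : leb.-integrable I01 (EFin \o (h \o Psi)).
    apply: measurable_bounded_integrable; [exact: m01|exact: leb_fin|by []|].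
    exists M; split; first exact: num_real.
    move=> N MN t t01 /=; apply: le_trans (ltW MN); apply: hM.
    by have [] := PsiP t t01.
  have fin := integrable_fin_num m01 ih.
  rewrite -(fineK fin); congr EFin; apply/eqP; rewrite -subr_eq0 -normr_eq0 eq_le normr_ge0 andbT.
  apply/ler_addgt0Pl => e e0; rewrite addr0.
  have e2 : 0 < e / 2 by rewrite divr_gt0.
  have [g [r [mg hg gr rl]]] := approx _ e2.
  have ig : leb.-integrable I01 (EFin \o g).
    apply: measurable_bounded_integrable; [exact: m01|exact: leb_fin|by []|].
    exists (M + e); split; first exact: num_real.
    move=> N MN t t01 /=; apply: le_trans (ltW MN).
    have := hg _ t01; have := hM _ (PsiP t t01).1; rewrite !ler_norml; lra.
  have -> : fine (\int[leb]_(t in I01) (h (Psi t))%:E) - l h =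
      (\int[leb]_(t in I01) (h (Psi t) - g t))%R + (r - l h).
    rewrite RintegralB//; have -> : (\int[leb]_(t in I01) g t)%R = r.
      by rewrite /Rintegral gr.
    by rewrite /Rintegral; ring.
  apply: le_trans (ler_normD _ _) _; rewrite (splitr e); apply: lerD => //.
  have ihg : leb.-integrable I01 (EFin \o (fun t => h (Psi t) - g t)).
    by apply: eq_integrable (integrableB m01 ih ig) => // t _ /=; rewrite EFinB.
  apply: le_trans (le_normr_Rintegral m01 ihg) _.
  apply: (@le_trans _ _ (\int[leb]_(t in I01) (e / 2))%R).
    apply: le_Rintegral => //.
    - by apply: eq_integrable (integrable_abse ihg).
    - apply: measurable_bounded_integrable; [exact: m01|exact: leb_fin|exact: measurable_cst|].
      exact: bounded_cst.
  rewrite Rintegral_cst//; have -> : fine (leb I01) = 1 by rewrite leb01.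
  by rewrite mulr1.
have phir : respects_family K f phi by exact: energy_respects.
exists Psi; split.
- by move=> t t01; have [] := PsiP t t01.
- move=> h Dh; rewrite -lL//; apply: intPsi; [exact: D_continuous|exact: D_respects].
(* [l phi] equals [upper phi], an infimum over majorants in [D]; the [g n] nearly attain it, so the
   nonnegative function [g n - phi] has integral at most [1 / (n + 1)] along [Psi]. *)
have /choice[g gP] : forall n : nat, exists g, [/\ D g, forall x, K x -> phi x <= g x &
    L g <= l phi + n.+1%:R^-1].
  move=> n; have n0 : 0 < n.+1%:R^-1 :> R by rewrite invr_gt0.
  have [_ [h [Dh ph] <-] hn] := inf_adherent n0 (upper_has_inf bphi).
  by exists h; split => //; rewrite l_phi ltW.
pose E n t := g n (Psi t) - phi (Psi t).
have Ec n : continuous (fun x => g n x - phi x).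
  move=> x; apply: cvgB; last exact: phic.
  by have [Dg _ _] := gP n; exact: D_continuous.
have mE n : measurable_fun I01 (E n) /\ (\int[leb]_(t in I01) (E n t)%:E <= n.+1%:R^-1%:E)%E.
  have [Dg gphi gl] := gP n.
  have [|mEn En] := intPsi _ (Ec n).
    by move=> x y Kx Ky xy; rewrite (D_respects Dg Kx Ky xy) (phir _ _ Kx Ky xy).
  split => //; rewrite En lee_fin.
  have -> : (fun x => g n x - phi x) = g n + (-1) *: phi.
    by apply/funext => x; rewrite scaleN1r.
  rewrite lD; [|exact: bD|exact: bounded_overZ].
  by rewrite lZ// lL// mulN1r lerBlDl.
have E0 n t : I01 t -> 0 <= E n t.
  by move=> t01; have [_ gphi _] := gP n; rewrite subr_ge0 gphi//; have [] := PsiP t t01.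
(* Parameters at which no [g n] comes within [1 / (k + 1)] of [phi]; Markov's inequality for every
   [n] shows that they form a null set. *)
pose bad k := \bigcap_n (I01 `&` [set t | k.+1%:R^-1 <= E n t]).
have mbad k : measurable (bad k).
  apply: bigcap_measurableType => n _.
  by apply: measurable_fun_le => //; have [] := mE n.
have bad01 k : bad k `<=` I01 by move=> t /(_ 0%N I)[].
have bad0 k : leb (bad k) = 0%E.
  have k0 : 0 < k.+1%:R^-1 :> R by rewrite invr_gt0.
  have bound n : (k.+1%:R^-1%:E * leb (bad k) <= n.+1%:R^-1%:E)%E.
    have [mEn En] := mE n.
    have mEn' : measurable_fun I01 (EFin \o E n) by exact/measurable_EFinP.
    rewrite -(integral_cst leb)//; apply: le_trans En.
    apply: (@le_trans _ _ (\int[leb]_(t in bad k) (E n t)%:E)%E).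
      apply: ge0_le_integral => //.
      - by move=> t _; rewrite lee_fin ltW.
      - by apply: measurable_funS mEn'.
      - by move=> t /(_ n I)[_]; rewrite /= lee_fin.
    apply: ge0_subset_integral => // t t01; by rewrite lee_fin E0.
  apply/eqP; rewrite eq_le measure_ge0 andbT.
  have finb : leb (bad k) \is a fin_num.
    rewrite ge0_fin_numE//; apply: (@le_lt_trans _ _ (leb I01)); last exact: leb_fin.
    by apply: le_measure => //; rewrite inE.
  rewrite -(fineK finb) lee_fin leNgt; apply/negP => b0.
  have /ltr_add_invr[n] : 0 < k.+1%:R^-1 * fine (leb (bad k)) by rewrite mulr_gt0.
  rewrite add0r ltNge => /negP; apply.
  by have := bound n; rewrite -(fineK finb) -EFinM lee_fin.
have neg : leb.-negligible (\bigcup_k bad k).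
  apply: negligible_bigcup => k; exists (bad k); split => //.
  exact: bad0.
apply: negligibleS neg.
move=> t /= nP; apply: contrapT => nbad; apply: nP => t01 x y Kx Ky mid h Dh.
apply: (D_respects Dh Kx Ky); apply: (@energy_strictly_convex R T f f1 (Psi t)).
  by move=> i; exact: mid.
(* Members of [D] respect the midpoint and [g n] majorizes [phi] at [x] and [y], so the mean of
   [phi x] and [phi y] is at most [g n (Psi t)], which off the bad sets is below [phi (Psi t) + e]
   for some [n]. Strict convexity then identifies [x] and [y] on the family. *)
apply/ler_addgt0Pl => e e0.
have [k ke] : exists k : nat, k.+1%:R^-1 < e.
  by have [k] := ltr_add_invr e0; rewrite add0r; exists k.
have [n nk] : exists n, E n t < k.+1%:R^-1.
  apply: contrapT => /forallNP H; apply: nbad; exists k => // n _; split => //.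
  by rewrite /= leNgt; apply/negP.
have [Dg gphi _] := gP n.
have := gphi _ Kx; have := gphi _ Ky; have := mid _ Dg; rewrite -/phi.
move: nk ke; rewrite /E; move: (k.+1%:R^-1) (phi _) (phi x) (phi y) (g n _) (g n x) (g n y).
by move=> *; lra.
Unshelve. all: end_near.
Qed.

End choquet.

(** * Countable bases of cozero sets *)

Section cozero_base.
Context {R : realType}.

(* The cozero sets [0 < c i] of a countable such family form a base; unlike
   a base of open sets it comes with the bounded continuous functions that
   the weak topology of measures tests against. *)
Definition cozero_base (X : topologicalType) (I : Type) (c : I -> X -> R) :=
  [/\ forall i, continuous (c i), forall i x, 0 <= c i x <= 1 &
      forall O x, open O -> O x -> exists i, 0 < c i x /\
        forall y, 0 < c i y -> O y].

Section separable.
Variable T : pseudoMetricType R.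

(** The distance truncated at 1, recovered from the balls; the entry 1 keeps the set nonempty. *)
Definition gauge (d y : T) : R := inf [set r : R | r = 1 \/ 0 < r /\ ball d r y].

Let gauge_lb (d y : T) : has_lbound [set r : R | r = 1 \/ 0 < r /\ ball d r y].
Proof. by exists 0 => r [->//|[/ltW]]. Qed.

Lemma gauge_ge0 d y : 0 <= gauge d y.
Proof. by apply: lb_le_inf; [exists 1; left|move=> r [->//|[/ltW]]]. Qed.

Lemma gauge_le d y r : 0 < r -> ball d r y -> gauge d y <= r.
Proof. by move=> r0 dr; apply: ge_inf => //; right. Qed.

Lemma gauge_lt d y r : r <= 1 -> gauge d y < r -> ball d r y.
Proof.
move=> r1 /inf_lt[]; first by exists 1; left.
move=> s [->|[s0 ds] sr]; first by move=> /(le_lt_trans r1); rewrite ltxx.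
exact: le_ball (ltW sr) _ ds.
Qed.

Let gauge_triangle d x y e : 0 < e -> ball x e y -> gauge d y <= gauge d x + e.
Proof.
move=> e0 xy; rewrite -lerBlDr; apply: lb_le_inf; first by exists 1; left.
move=> r [->|[r0 dr]]; rewrite lerBlDr.
  apply: (@le_trans _ _ 1); last by rewrite lerDl ltW.
  by apply: ge_inf => //; left.
by apply: gauge_le; [exact: addr_gt0|exact: ball_triangle dr xy].
Qed.

Lemma gauge_continuous d : continuous (gauge d).
Proof.
move=> x; apply/cvgrPdist_le => e e0; near=> y.
have xy : ball x e y by near: y; exact: nbhsx_ballx.
rewrite ler_distlC; apply/andP; split; last exact: gauge_triangle.
by rewrite lerBlDr; apply: gauge_triangle => //; exact: ball_sym.
Unshelve. all: end_near. Qed.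

Lemma cozero_base_count (X : topologicalType) (I : countType) (c : I -> X -> R) :
  cozero_base c -> exists c' : nat -> X -> R, cozero_base c'.
Proof.
move=> [cc c01 cb]; exists (fun k => if unpickle k is Some i then c i else cst 0); split.
- by move=> k; case: unpickle => // x; exact: cvg_cst.
- by move=> k x; case: unpickle => //=; rewrite lexx ler01.
- move=> O x oO Ox; have [i [cx ci]] := cb _ _ oO Ox.
  by exists (pickle i); rewrite pickleK.
Qed.

Lemma cozero_base_separable (D : set T) (x0 : T) : countable D -> dense D ->
  exists c : nat -> T -> R, cozero_base c.
Proof.
move=> /countable_injP[g ginj] dD.
have /choice[u uP] : forall j : nat, exists x, forall y, D y -> g y = j -> x = y.
  move=> j; have [[x [Dx xj]]|nx] := pselect (exists x, D x /\ g x = j).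
    by exists x => y Dy yj; apply: ginj; rewrite ?inE// xj yj.
  by exists x0 => y Dy yj; exfalso; apply: nx; exists y.
(* A bump around the dense point of code [j], positive where the gauge is below [1 / (k + 1)]. *)
pose c (jk : nat * nat) y := Num.max 0 (jk.2.+1%:R^-1 - gauge (u jk.1) y).
apply: (@cozero_base_count T _ c); split.
- move=> [j k] x; rewrite /c /=.
  have := @gauge_continuous (u j) x.
  move=> H; apply: (@continuous_max _ _ (cst 0) (fun y => k.+1%:R^-1 - gauge (u j) y)).
    exact: cvg_cst.
  by apply: cvgB; [exact: cvg_cst|exact: H].
- move=> [j k] x; rewrite /c /= le_max lexx /= ge_max ler01 /=.
  rewrite lerBlDr (@le_trans _ _ 1)// ?lerDl ?gauge_ge0//.
  by rewrite invf_le1// ler1n.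
- move=> O x oO Ox.
  have /nbhs_ballP[e /= e0 eO] : nbhs x O by exact: open_nbhs_nbhs.
  (* With the radius [r] below [e / 2] and a dense point within [r / 2] of [x], the bump is positive
     at [x] and its support set stays within [3 r / 2 < e] of [x]. *)
  have [k] := ltr_add_invr (divr_gt0 e0 (ltr0n R 2)); rewrite add0r => ke.
  set r := k.+1%:R^-1 in ke; have r0 : 0 < r by rewrite invr_gt0.
  have r1 : r <= 1 by rewrite invf_le1// ler1n.
  have r2 : 0 < r / 2 by rewrite divr_gt0.
  have ne : (ball x (r / 2))° !=set0 by exists x; exact: nbhsx_ballx.
  have [d [xd Dd]] := dD _ ne (@open_interior _ _).
  have {}xd := interior_subset xd.
  have ud : u (g d) = d by exact: uP.
  exists (g d, k); rewrite /c /= ud; split.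
    rewrite lt_max ltxx /= subr_gt0 -/r.
    apply: (@le_lt_trans _ _ (r / 2)); last by lra.
    by apply: gauge_le; [lra|exact: ball_sym].
  move=> y; rewrite lt_max ltxx /= subr_gt0 -/r => /(gauge_lt r1) dy.
  apply: eO; apply: (@le_ball _ _ _ (r / 2 + r)); first by lra.
  exact: ball_triangle xd dy.
Qed.

End separable.

Lemma cozero_base_prod (X Y : topologicalType) I J (c : I -> X -> R) (d : J -> Y -> R) :
  cozero_base c -> cozero_base d ->
  cozero_base (fun (ij : I * J) (z : X * Y) => c ij.1 z.1 * d ij.2 z.2).
Proof.
move=> [cc c01 cb] [dc d01 db]; split.
- move=> [i j] [x y] /=.
  apply: cvgM; [apply: (cvg_comp _ _ cvg_fst)|apply: (cvg_comp _ _ cvg_snd)].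
    exact: cc.
  exact: dc.
- move=> [i j] [x y] /=; have /andP[? ?] := c01 i x; have /andP[? ?] := d01 j y.
  by rewrite mulr_ge0//= mulr_ile1.
- move=> O [x y] oO Oxy.
  have [[A B] /= [nA nB] AB] : nbhs (x, y) O by exact: open_nbhs_nbhs.
  move: nA nB; rewrite !nbhsE /= => -[A' [oA' A'x] A'A] [B' [oB' B'y] B'B].
  have [i [ci ciA]] := cb _ _ oA' A'x; have [j [dj djB]] := db _ _ oB' B'y.
  exists (i, j); split => /=; first exact: mulr_gt0.
  move=> [a b] /= ab; apply: AB; split => /=.
    apply/A'A/ciA; have /andP[] := c01 i a; rewrite le_eqVlt => /orP[/eqP c0|//].
    by rewrite -c0 mul0r ltxx in ab.
  apply/B'B/djB; have /andP[] := d01 j b; rewrite le_eqVlt => /orP[/eqP d0|//].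
  by rewrite -d0 mulr0 ltxx in ab.
Qed.

Lemma continuous_prod (X : topologicalType) I (r : seq I) (F : I -> X -> R) :
  (forall i, continuous (F i)) -> continuous (fun x => \prod_(i <- r) F i x).
Proof.
move=> cF; elim: r => [|i r IH] x.
  by under eq_fun do rewrite big_nil; exact: cvg_cst.
under eq_fun do rewrite big_cons.
by apply: cvgM; [exact: cF|exact: IH].
Qed.

Section dprod.
Variables (n : nat) (T : 'I_n -> ptopologicalType).

Lemma dprod_proj_continuous k : continuous (fun x : dprod T => x k).
Proof. exact: (@proj_continuous _ T k). Qed.

(** The boxes around [x] generate a filter; it converges to [x] because it does so in each
    coordinate, hence every neighbourhood contains a box. *)
Lemma dprod_box (O : set (dprod T)) (x : dprod T) : open O -> O x ->
  exists V : forall k, set (T k), (forall k, open_nbhs (x k) (V k)) /\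
    forall y : dprod T, (forall k, V k (y k)) -> O y.
Proof.
move=> oO Ox.
pose F : set_system (dprod T) := filter_from
  [set V : forall k, set (T k) | forall k, open_nbhs (x k) (V k)]
  (fun V => [set y | forall k, V k (y k)]).
have FF : Filter F.
  apply: filter_from_filter; first by exists (fun=> setT) => k; split => //; exact: openT.
  move=> V V' /= Vx V'x; exists (fun k => V k `&` V' k).
    move=> k; have [? ?] := Vx k; have [? ?] := V'x k.
    by split; [exact: openI|split].
  by move=> y /= VV'; split=> k; have [] := VV' k.
have Fx : F --> x.
  apply/cvg_sup => k A; rewrite (@nbhsE (initial_topology _)) => -[_ [[B oB <-] Bx] BA].
  (* Only coordinate [k] is constrained; [ecast] carries [B] from [T k] to [T j] along [k = j]. *)
  exists (fun j => if pselect (k = j) is left e then (ecast j (set (T j)) e B) else setT).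
    move=> j; case: pselect => [e|_]; last by split => //; exact: openT.
    by case: j / e.
  move=> y /= /(_ k); case: pselect => // e; rewrite (Prop_irrelevance e erefl) => By.
  exact: BA.
have [V Vx VO] := Fx O (open_nbhs_nbhs (conj oO Ox)).
by exists V.
Qed.

Lemma cozero_base_dprod (I : 'I_n -> Type) (c : forall k, I k -> T k -> R) :
  (forall k, cozero_base (c k)) ->
  cozero_base (fun (a : forall k, I k) (x : dprod T) => \prod_k c k (a k) (x k)).
Proof.
move=> cb; split.
- move=> a; apply: continuous_prod => k x.
  have [ck _ _] := cb k.
  by apply: (cvg_comp _ _ (@dprod_proj_continuous k x)); exact: ck.
- move=> a x; apply/andP; split.
    by apply: prodr_ge0 => k _; have [_ /(_ (a k) (x k))/andP[]] := cb k.
  by apply: prodr_ile1 => k _; have [_ /(_ (a k) (x k))] := cb k.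
- move=> O x oO Ox; have [V [Vx VO]] := dprod_box oO Ox.
  have aE : forall k, exists i, 0 < c k i (x k) /\ forall y, 0 < c k i y -> V k y.
    by move=> k; have [_ _] := cb k; have [oV Vk] := Vx k; apply.
  pose a k := sval (cid (aE k)); have aP k := svalP (cid (aE k)).
  exists a; split; first by apply: prodr_gt0 => k _; have [] := aP k.
  move=> y ay; apply: VO => k; apply: (aP k).2.
  have [_ /(_ (a k) (y k))/andP[+ _] _] := cb k; rewrite le_eqVlt => /orP[/eqP c0|//].
  by move: ay; rewrite (bigD1 k)//= -c0 mul0r ltxx.
Qed.

End dprod.
End cozero_base.

(** * Borel measurability and integrals of bounded continuous functions *)

Section borel_measurability.
Context {R : realType}.

Lemma continuous_borel (X Y : ptopologicalType) (f : X -> Y) :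
  continuous f -> measurable_fun setT (f : borel X -> borel Y).
Proof.
move=> /continuousP cf; apply: (@measurability _ _ _ (borel Y) _ _ open) => //.
by move=> _ [V oV <-]; rewrite setTI; apply: sub_sigma_algebra; exact: cf.
Qed.

Lemma continuous_measurable_real (X : ptopologicalType) (f : X -> R) :
  continuous f -> measurable_fun setT (f : borel X -> R).
Proof.
move=> /continuousP cf; apply: (measurability _ (RGenOInfty.measurableE R)).
move=> _ [_ [a ->] <-]; rewrite setTI; apply: sub_sigma_algebra; apply: cf.
exact: interval_open.
Qed.

Lemma open_borel (X : ptopologicalType) (O : set (borel X)) :
  open (O : set X) -> measurable O.
Proof. exact: sub_sigma_algebra. Qed.

Section prob_integral.
Context {X : ptopologicalType}.
Implicit Types (P Q : probability (borel X) R) (f : bcfun R X).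

Lemma measurable_bcfun f : measurable_fun setT (sval f : borel X -> R).
Proof. by apply: continuous_measurable_real; have [] := svalP f. Qed.

Lemma bcfun_integrable P f : P.-integrable setT (EFin \o (sval f : borel X -> R)).
Proof.
apply: measurable_bounded_integrable; [exact: measurableT| |exact: measurable_bcfun|].
- by apply: fin_num_fun_lty; exact: fin_num_measure.
- have [_ [M fM]] := svalP f; exists M; split; first exact: num_real.
  by move=> N MN x _ /=; apply: le_trans (fM x) (ltW MN).
Qed.

Lemma prob_integralE P f :
  (\int[P]_x ((sval f : borel X -> R) x)%:E)%E = (prob_integral P f)%:E.
Proof. by rewrite /prob_integral fineK// integrable_fin_num//; exact: bcfun_integrable. Qed.

End prob_integral.
End borel_measurability.

(** * Countably many test functions that determine a probability *)

Section cozero_tests.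
Context {R : realType} {X : ptopologicalType} {I : countType}.
Variable c : I -> X -> R.
Hypothesis cb : cozero_base c.

(** Finite products are taken so that the cozero sets are closed under intersection and form a
    pi-system. *)
Definition cozero_prod (s : seq I) (x : X) : R := \prod_(i <- s) c i x.

Let cozero_prod_ge0 s x : 0 <= cozero_prod s x.
Proof. by apply: prodr_ge0 => i _; have [_ /(_ i x)/andP[]] := cb. Qed.

Lemma cozero_prod_continuous s : continuous (cozero_prod s).
Proof. by apply: continuous_prod => i; have [] := cb. Qed.

(** As [k.2] grows these bounded continuous functions tend to the indicator of the cozero set of
    [k.1]. *)
Definition test_fun (k : seq I * nat) x : R := Num.min 1 (k.2%:R * cozero_prod k.1 x).

Lemma test_fun01 k x : 0 <= test_fun k x <= 1.
Proof.
by rewrite /test_fun le_min ler01 ge_min lexx /= andbT mulr_ge0.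
Qed.

Lemma test_fun_continuous k : continuous (test_fun k).
Proof.
move=> x; apply: (@continuous_min _ _ (cst 1) (fun y => k.2%:R * cozero_prod k.1 y)).
  exact: cvg_cst.
by apply: cvgM; [exact: cvg_cst|exact: cozero_prod_continuous].
Qed.

Lemma test_fun_bc k : continuous (test_fun k) /\ exists M : R, forall x, `|test_fun k x| <= M.
Proof.
split; first exact: test_fun_continuous.
by exists 1 => x; have /andP[? ?] := test_fun01 k x; rewrite ger0_norm.
Qed.

Definition test_bc k : bcfun R X := exist _ _ (test_fun_bc k).

Definition cozero_set (s : seq I) : set (borel X) := [set x | 0 < cozero_prod s x].

Lemma cozero_set_open s : open (cozero_set s : set X).
Proof.
have cs : continuous (cozero_prod s) by exact: cozero_prod_continuous.
have /= oI : open (`]0, +oo[%classic : set R) by exact: interval_open.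
by move/continuousP : cs => /(_ _ oI); rewrite preimage_itvoy.
Qed.

Lemma cozero_set_measurable s : measurable (cozero_set s).
Proof. by apply: open_borel; exact: cozero_set_open. Qed.

Lemma cozero_setI : setI_closed (range cozero_set).
Proof.
move=> _ _ [s _ <-] [t _ <-]; exists (s ++ t) => //.
apply/seteqP; split=> x; rewrite /cozero_set /= /cozero_prod big_cat /=;
  rewrite -!/(cozero_prod _ x).
  have := cozero_prod_ge0 s x; have := cozero_prod_ge0 t x.
  rewrite !le_eqVlt => /orP[/eqP<-|?] /orP[/eqP<-|?] //; rewrite ?mulr0 ?mul0r ?ltxx//.
by move=> [? ?]; exact: mulr_gt0.
Qed.

(** An open set is the union of the base sets that it contains, and [I] is countable. *)
Lemma borel_cozero : @measurable _ (borel X) = <<s range cozero_set >>.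
Proof.
apply/seteqP; split; last first.
  apply: smallest_sub; first exact: sigma_algebra_measurable.
  by move=> _ [s _ <-]; exact: cozero_set_measurable.
apply: smallest_sub; first exact: smallest_sigma_algebra.
move=> O oO.
pose F (k : nat) : set X := if unpickle k is Some i then
  (if pselect (cozero_set [:: i] `<=` O) then cozero_set [:: i] else set0) else set0.
have -> : O = \bigcup_k F k.
  apply/seteqP; split=> [x Ox|x [k _]]; last first.
    by rewrite /F; case: unpickle => // i; case: (pselect (cozero_set [:: i] `<=` O)) => // iO xi; exact: iO xi.
  have [_ _ /(_ O x oO Ox)[i [ci iO]]] := cb.
  exists (pickle i) => //; rewrite /F pickleK; case: pselect => [iS|nS].
    by rewrite /cozero_set /= /cozero_prod big_seq1.
  exfalso; apply: nS => y; rewrite /cozero_set /= /cozero_prod big_seq1; exact: iO.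
apply: sigma_algebra_bigcup => k; rewrite /F.
case: unpickle => [i|]; last exact: sigma_algebra0.
case: pselect => [iO|niO]; last exact: sigma_algebra0.
by apply: sub_sigma_algebra; exists [:: i].
Qed.

Lemma test_fun_cvg s (x : X) : test_fun (s, m) x @[m --> \oo] --> (\1_(cozero_set s) x : R).
Proof.
rewrite indicE; have := cozero_prod_ge0 s x; rewrite le_eqVlt => /orP[/eqP x0|x0].
  rewrite memNset ?/cozero_set /= -?x0 ?ltxx//.
  apply: cvg_near_cst; apply: nearW => m; rewrite /test_fun /= -x0 mulr0.
  by apply/eqP; rewrite eq_le; apply/andP; split; rewrite ?ge_min ?le_min ?lexx ?ler01 ?orbT.
rewrite mem_set//=; apply: cvg_near_cst; near=> m.
rewrite /test_fun /=; apply/min_idPl; rewrite -ler_pdivrMr// mul1r.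
by near: m; exact: nbhs_infty_ger.
Unshelve. all: end_near. Qed.

Lemma prob_integral_cvg (P : probability (borel X) R) s :
  (prob_integral P (test_bc (s, m)))%:E @[m --> \oo] --> P (cozero_set s).
Proof.
under eq_fun do rewrite -prob_integralE.
rewrite -[P _]/(P _) -[cozero_set s]setIT -integral_indic//; last first.
  exact: cozero_set_measurable.
apply: (@dominated_cvg _ _ _ _ _ _ _ _ (cst 1%E)) => //.
- by move=> m; apply/measurable_EFinP; exact: measurable_bcfun.
- by move=> x _; apply: cvg_EFin; [exact: nearW|exact: test_fun_cvg].
- exact: finite_measure_integrable_cst.
- move=> m x _ /=; have /andP[? ?] := test_fun01 (s, m) x.
  by rewrite lee_fin ger0_norm.
Qed.

(** Dynkin induction for a property [G] of the evaluations [z |-> H z B]; it yields both the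
    equality of two probabilities and the measurability of a family of them. *)
Lemma probability_cozero_ind (Z : Type) (H : Z -> probability (borel X) R)
    (G : (Z -> \bar R) -> Prop) :
  G (fun=> 1%E) ->
  (forall k, G (fun z => (prob_integral (H z) (test_bc k))%:E)) ->
  (forall u v, (forall z, u ^~ z @ \oo --> v z) -> (forall m : nat, G (u m)) -> G v) ->
  (forall u, G u -> G (fun z => (1 - u z)%E)) ->
  (forall u : nat -> Z -> \bar R, (forall m z, 0 <= u m z)%E ->
    (forall m, G (u m)) -> G (fun z => \sum_(m <oo) u m z)%E) ->
  forall B : set (borel X), measurable B -> G (fun z => H z B).
Proof.
move=> G1 Gtest Gcvg GC Gsum B; rewrite borel_cozero.
apply: (@dynkin_induction _ (borel X) (range cozero_set) (fun B => G (fun z => H z B))).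
- exact: borel_cozero.
- exact: cozero_setI.
- by under eq_fun do rewrite probability_setT.
- move=> _ [s _ <-]; apply: (Gcvg (fun m z => (prob_integral (H z) (test_bc (s, m)))%:E)) => //.
  by move=> z; exact: prob_integral_cvg.
- move=> S mS GS; have -> : (fun z => H z (~` S)) = (fun z => (1 - H z S)%E).
    by apply/funext => z; rewrite probability_setC.
  exact: GC.
- move=> F mF tF GF.
  have -> : (fun z => H z (\bigcup_k F k)) = (fun z => \sum_(m <oo) H z (F m))%E.
    apply/funext => z; rewrite measure_semi_bigcup//; exact: bigcup_measurable.
  exact: (Gsum (fun m z => H z (F m))).
Qed.

Lemma eq_probability_tests (P Q : probability (borel X) R) :
  (forall k, prob_integral P (test_bc k) = prob_integral Q (test_bc k)) ->
  forall B, measurable B -> P B = Q B.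
Proof.
(* The two probabilities form a family indexed by [bool], and equality is a property of its
   evaluations. *)
move=> PQ B mB; pose H (b : bool) := if b then P else Q.
apply: (@probability_cozero_ind bool H (fun u => u true = u false) _ _ _ _ _ B) => //.
- by move=> k /=; rewrite PQ.
- move=> u v uv ueq; have := uv true.
  by under eq_fun do rewrite ueq; move=> /cvg_lim<-//; apply/cvg_lim => //; exact: uv.
- by move=> u ->.
- by move=> u _ uE; apply: eq_eseriesr => m _; exact: uE.
Qed.

Lemma measurable_probability_tests d (Z : measurableType d) (D : set Z)
    (H : Z -> probability (borel X) R) : measurable D ->
  (forall k, measurable_fun D (fun z => prob_integral (H z) (test_bc k))) ->
  forall B, measurable B -> measurable_fun D (fun z => H z B).
Proof.
move=> mD mH B mB.
apply: (@probability_cozero_ind Z H (fun u => measurable_fun D u) _ _ _ _ _ B) => //.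
- by move=> k; apply/measurable_EFinP; exact: mH.
- by move=> u v uv mu; apply: (@emeasurable_fun_cvg _ _ _ D u v mu) => z _; exact: uv.
- by move=> u mu; apply: emeasurable_funB.
- move=> u u0 mu; exact: ge0_emeasurable_sum.
Qed.

End cozero_tests.

(** * Construction of probabilities and integration against mixtures *)

Section nonneg_induction.
Context {R : realType} d (X : measurableType d).
Local Open Scope ereal_scope.

Import HBNNSimple.

Lemma nonneg_measurable_ind (G : (X -> \bar R) -> Prop) :
  (forall A, measurable A -> G (fun x => (\1_A x)%:E)) ->
  (forall (r : R) f, (0 <= r)%R -> measurable_fun setT f -> (forall x, 0 <= f x) ->
    G f -> G (fun x => r%:E * f x)) ->
  (forall f g, measurable_fun setT f -> measurable_fun setT g ->
    (forall x, 0 <= f x) -> (forall x, 0 <= g x) -> G f -> G g ->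
    G (fun x => f x + g x)) ->
  (forall (f : nat -> X -> \bar R), (forall n, measurable_fun setT (f n)) ->
    (forall n x, 0 <= f n x) -> (forall x, nondecreasing_seq (f ^~ x)) ->
    (forall n, G (f n)) -> G (fun x => limn (f ^~ x))) ->
  forall f, measurable_fun setT f -> (forall x, 0 <= f x) -> G f.
Proof.
move=> Gind GZ GD Glim f mf f0.
have fE : f = (fun x => limn (fun n => (nnsfun_approx measurableT mf n x)%:E)).
  by apply/funext => x; apply/esym/cvg_lim => //; exact: cvg_nnsfun_approx.
rewrite fE; apply: Glim => [n|n x|x m n mn|n].
- exact/measurable_EFinP.
- by rewrite lee_fin.
- by rewrite lee_fin; exact/lefP/nd_nnsfun_approx.
move: (nnsfun_approx _ _ _) => {fE mf f0 n}f.
pose s : seq R := finmap.enum_fset (fset_set (f @` setT)).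
have s0 i : (0 <= s`_i)%R.
  have [si|si] := ltnP i (size s); last by rewrite nth_default.
  have : s`_i \in s by exact: mem_nth.
  by rewrite /s in_fset_set// inE => -[x _ <-].
have -> : (fun x => (f x)%:E) =
    (fun x => (\sum_(i < size s) (s`_i * \1_(f @^-1` [set s`_i]) x))%R%:E).
  by apply/funext => x; congr EFin; exact: fimfunEord.
have m1 y : measurable_fun setT (\1_(f @^-1` [set y]) : X -> R).
  by apply: measurable_indic; exact: measurable_sfunP.
have msum k : measurable_fun setT (fun x => \sum_(i < k) (s`_i * \1_(f @^-1` [set s`_i]) x))%R.
  apply: measurable_sum => i; apply: measurable_funM; [exact: measurable_cst|exact: m1].
have sum0 k x : (0 <= \sum_(i < k) (s`_i * \1_(f @^-1` [set s`_i]) x))%R.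
  by apply: sumr_ge0 => i _; rewrite mulr_ge0// indicE.
elim: (size s) => [|k IH].
  have -> : (fun x => (\sum_(i < 0) (s`_i * \1_(f @^-1` [set s`_i]) x))%R%:E) =
      (fun x => (\1_(@set0 X) x)%:E).
    by apply/funext => x; rewrite big_ord0 indic0.
  exact: Gind.
have -> : (fun x => (\sum_(i < k.+1) (s`_i * \1_(f @^-1` [set s`_i]) x))%R%:E) =
    (fun x => (\sum_(i < k) (s`_i * \1_(f @^-1` [set s`_i]) x))%R%:E +
      (s`_k)%:E * (\1_(f @^-1` [set s`_k]) x)%:E).
  by apply/funext => x; rewrite big_ord_recr /= EFinD EFinM.
have mk : measurable_fun setT (fun x => (\1_(f @^-1` [set s`_k]) x)%:E : \bar R).
  by apply/measurable_EFinP; exact: m1.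
apply: GD => //.
- exact/measurable_EFinP.
- exact: measurable_funeM.
- by move=> x; rewrite lee_fin.
- by move=> x; rewrite -EFinM lee_fin mulr_ge0// indicE.
- apply: GZ; [exact: s0|exact: mk|by move=> x; rewrite lee_fin indicE|].
  by apply: Gind; exact: measurable_sfunP.
Qed.

End nonneg_induction.

Section probability_of_set_function.
Context {R : realType} d (T : measurableType d).
Variable f : set T -> \bar R.
Hypothesis f0 : f set0 = 0%E.
Hypothesis f_ge0 : forall A, (0 <= f A)%E.
Hypothesis f_add : semi_sigma_additive f.
Hypothesis f1 : f setT = 1%E.

Definition set_function := f.
HB.instance Definition _ := isMeasure.Build _ _ _ set_function f0 f_ge0 f_add.
HB.instance Definition _ := Measure_isProbability.Build _ _ _ set_function f1.

Lemma probability_of_set_function : exists P : probability T R, forall A, P A = f A.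
Proof. by exists set_function. Qed.

End probability_of_set_function.

Section mixture.
Context {R : realType} d d' (Z : measurableType d) (T : measurableType d').
Variables (eta : probability Z R) (D : set Z) (H : Z -> probability T R).
Hypothesis mD : measurable D.
Hypothesis eta_D : eta D = 1%E.
Hypothesis mH : forall B, measurable B -> measurable_fun D (fun z => H z B).
Local Open Scope ereal_scope.

Lemma mixture_probability : exists P : probability T R,
  forall B, P B = \int[eta]_(z in D) H z B.
Proof.
apply: (@probability_of_set_function _ _ _ (fun B => \int[eta]_(z in D) H z B)).
- by rewrite integral0_eq// => z _; rewrite measure0.
- by move=> B; apply: integral_ge0 => z _; exact: measure_ge0.
- move=> F mF tF mUF; have -> : \int[eta]_(z in D) H z (\bigcup_n F n) =
      \int[eta]_(z in D) (\sum_(n <oo) H z (F n)).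
    by apply: eq_integral => z _; rewrite measure_semi_bigcup.
  rewrite integral_nneseries//; last by move=> n; exact: mH.
  apply: is_cvg_ereal_nneg_natsum => n _.
  by apply: integral_ge0 => z _; exact: measure_ge0.
- under eq_integral do rewrite probability_setT.
  by rewrite integral_cst// mul1e.
Qed.

Variable P : probability T R.
Hypothesis PE : forall B, measurable B -> P B = \int[eta]_(z in D) H z B.

(** The definition of the mixture is the case of indicators; scaling, sums and monotone limits pass
    through both integrals. *)
Lemma integral_mixture (f : T -> \bar R) : measurable_fun setT f -> (forall x, 0 <= f x) ->
  measurable_fun D (fun z => \int[H z]_x f x) /\
  \int[P]_x f x = \int[eta]_(z in D) \int[H z]_x f x.
Proof.
move: f; apply: (@nonneg_measurable_ind _ _ _ (fun f =>
  measurable_fun D (fun z => \int[H z]_x f x) /\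
  \int[P]_x f x = \int[eta]_(z in D) \int[H z]_x f x)).
- move=> A mA; have E z : \int[H z]_x (\1_A x)%:E = H z A by rewrite integral_indic// setIT.
  under eq_fun do rewrite E; split; first exact: mH.
  transitivity (P A); first by rewrite integral_indic// setIT.
  by rewrite PE//; apply: eq_integral => z _; rewrite E.
- move=> r f r0 mf f0 [mHf Pf].
  have E (Q : probability T R) : \int[Q]_x (r%:E * f x) = r%:E * \int[Q]_x f x.
    by rewrite ge0_integralZl_EFin.
  under eq_fun do rewrite E; split; first exact: measurable_funeM.
  rewrite E Pf.
  by rewrite ge0_integralZl_EFin// => z _; exact: integral_ge0.
- move=> f g mf mg f0 g0 [mHf Pf] [mHg Pg].
  have E (Q : probability T R) : \int[Q]_x (f x + g x) = \int[Q]_x f x + \int[Q]_x g x.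
    by rewrite ge0_integralD.
  under eq_fun do rewrite E; split; first exact: emeasurable_funD.
  rewrite E Pf Pg.
  by symmetry; apply: ge0_integralD => // z _; exact: integral_ge0.
- move=> f mf f0 ndf IH.
  have E (Q : probability T R) : \int[Q]_x limn (f ^~ x) = limn (fun n => \int[Q]_x f n x).
    by rewrite monotone_convergence// => x _; exact: ndf.
  have nd (Q : probability T R) : nondecreasing_seq (fun n => \int[Q]_x f n x).
    move=> m n mn; apply: ge0_le_integral => // x _; exact: ndf.
  have mHf n : measurable_fun D (fun z => \int[H z]_x f n x) by have [] := IH n.
  under eq_fun do rewrite E; split.
    apply: (@emeasurable_fun_cvg _ _ _ D (fun n z => \int[H z]_x f n x)) => // z _.
    exact: ereal_nondecreasing_is_cvgn.
  rewrite E monotone_convergence//; last by move=> n z _; exact: integral_ge0.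
  by congr (limn _); apply/funext => n; have [] := IH n.
Qed.

End mixture.

Lemma prob_integral_mixture {R : realType} d (Z : measurableType d) (X : ptopologicalType)
    (eta : probability Z R) (D : set Z) (H : Z -> probability (borel X) R)
    (P : probability (borel X) R) : measurable D -> eta D = 1%E ->
  (forall B, measurable B -> measurable_fun D (fun z => H z B)) ->
  (forall B, measurable B -> P B = \int[eta]_(z in D) H z B)%E ->
  forall f : bcfun R X, measurable_fun D (fun z => prob_integral (H z) f) /\
    (\int[eta]_(z in D) (prob_integral (H z) f)%:E)%E = (prob_integral P f)%:E.
Proof.
move=> mD eD mH PE f.
(* Adding the bound [M] makes the integrand nonnegative, as [integral_mixture] requires; the
   constant is subtracted again at the end. *)
have [cf [M fM]] := svalP f; pose g (x : borel X) := ((sval f x + M)%R%:E : \bar R).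
have mg : measurable_fun setT g.
  by apply/measurable_EFinP; apply: measurable_funD => //; exact: measurable_bcfun.
have g0 x : (0 <= g x)%E.
  by rewrite lee_fin -lerBlDr sub0r; have := fM x; rewrite ler_norml => /andP[].
have gE (Q : probability (borel X) R) : (\int[Q]_x g x = (prob_integral Q f + M)%R%:E)%E.
  rewrite EFinD -prob_integralE.
  have ib := bcfun_integrable Q f.
  have iM := @finite_measure_integrable_cst _ _ _ Q setT M measurableT.
  rewrite -[M%:E]mule1 -(probability_setT Q) -(integral_cst Q measurableT M%:E).
  by rewrite -(integralD measurableT ib iM).
have [mHg Pg] := integral_mixture mD mH PE mg g0.
have mf : measurable_fun D (fun z => prob_integral (H z) f).
  have -> : (fun z => prob_integral (H z) f) = (fun z => fine (\int[H z]_x g x)%E - M).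
    by apply/funext => z; rewrite gE /= addrK.
  apply: measurable_funB => //.
  exact: (measurableT_comp (@fine_measurable _ setT measurableT) mHg).
split => //.
have ig : eta.-integrable D (fun z => \int[H z]_x g x)%E.
  apply/integrableP; split => //.
  under eq_integral do rewrite gee0_abs ?integral_ge0//.
  by rewrite -Pg gE ltry.
have -> : (\int[eta]_(z in D) (prob_integral (H z) f)%:E =
    \int[eta]_(z in D) (\int[H z]_x g x - M%:E))%E.
  by apply: eq_integral => z _; rewrite gE -EFinB addrK.
have eM : (\int[eta]_(z in D) (EFin \o cst M) z = M%:E)%E.
  by transitivity (M%:E * eta D)%E; [exact: (integral_cst eta mD M%:E)|rewrite eD mule1].
rewrite (integralB mD ig (@finite_measure_integrable_cst _ _ _ eta D M mD)).
by rewrite -Pg gE eM -EFinB addrK.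
Qed.

Lemma pushforward_probability {R : realType} d d' (S : measurableType d)
    (T : measurableType d') (mu : probability S R) (f : S -> T) :
  measurable_fun setT f ->
  exists P : probability T R, forall B, measurable B -> P B = mu (f @^-1` B).
Proof.
move=> mf.
have mfp B : measurable B -> measurable (f @^-1` B).
  by move=> mB; rewrite -[X in measurable X]setTI; exact: mf.
pose m (B : set T) : \bar R := if pselect (measurable B) then mu (f @^-1` B) else 0%E.
have mE B : measurable B -> m B = mu (f @^-1` B) by rewrite /m; case: pselect.
have [||||P PE] := @probability_of_set_function R _ T m; last first.
- by exists P => B mB; rewrite PE mE.
- by rewrite mE// preimage_setT probability_setT.
- move=> F mF tF mUF; rewrite mE// preimage_bigcup.
  have -> : (fun n => \sum_(0 <= i < n) m (F i))%E =
      (fun n => \sum_(0 <= i < n) mu (f @^-1` F i))%E.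
    by apply/funext => n; apply: eq_bigr => i _; rewrite mE.
  apply: measure_semi_sigma_additive.
  + by move=> n; exact: mfp.
  + apply/trivIsetP => i j _ _ ij; rewrite -preimage_setI.
    by move/trivIsetP : tF => /(_ _ _ I I ij) ->; rewrite preimage_set0.
  + by rewrite -preimage_bigcup; exact: mfp.
- by move=> B; rewrite /m; case: pselect => [mB|nB]; [exact: measure_ge0|exact: lexx].
- by rewrite mE// preimage_set0 measure0.
Qed.

(** * The team space and its measurable rectangles *)

Lemma continuous_pair (Z A B : topologicalType) (f : Z -> A) (g : Z -> B) :
  continuous f -> continuous g -> continuous (fun z => (f z, g z)).
Proof.
move=> cf cg z.
exact: (@cvg_pair _ _ _ (nbhs z) (nbhs (f z)) (nbhs (g z)) _ _ _ f g (cf z) (cg z)).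
Qed.

Lemma continuous_after (Z A B : topologicalType) (f : Z -> A) (g : A -> B) :
  continuous f -> continuous g -> continuous (fun z => g (f z)).
Proof. by move=> cf cg z; exact: (continuous_comp (cf z) (cg (f z))). Qed.

Lemma continuous_fst (A B : topologicalType) : continuous (@fst A B).
Proof. by move=> z; exact: cvg_fst. Qed.

Lemma continuous_snd (A B : topologicalType) : continuous (@snd A B).
Proof. by move=> z; exact: cvg_snd. Qed.

Lemma continuous_dprod (n : nat) (T : 'I_n -> ptopologicalType) (Z : topologicalType)
    (f : Z -> dprod T) :
  (forall k, continuous (fun z => f z k)) -> continuous f.
Proof.
move=> cf z; apply/cvg_sup => k A; rewrite (@nbhsE (initial_topology _)).
move=> [_ [[V oV <-] Vz] VA]; apply: filterS VA _.
by apply: (cf k z); exact: open_nbhs_nbhs.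
Qed.

Section team_space.
Context {R : realType} {n : nat} {Om : ptopologicalType}.
Context {Y U : 'I_n -> ptopologicalType}.

Local Notation MS := (MS Om Y).
Local Notation XS := (XS Om Y U).

Definition obs (x : XS) : MS := (x.1, fun k => (x.2 k).1).
Definition act k (x : XS) : U k := (x.2 k).2.

Lemma rectE (A : set MS) (C : forall k, set (U k)) :
  rect A C = obs @^-1` A `&` \bigcap_k (act k @^-1` C k).
Proof.
apply/seteqP; split=> x [Ax Cx]; first by split => // k _; exact: Cx.
by split => // k; exact: Cx.
Qed.

Lemma comp_dprod_continuous k : continuous (fun x : XS => x.2 k).
Proof.
exact: (continuous_after (@continuous_snd Om (dprod _))
  (@dprod_proj_continuous n (fun k => (Y k * U k)%type) k)).
Qed.

Lemma obs_continuous : continuous obs.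
Proof.
apply: (@continuous_pair XS Om (dprod Y)); first exact: continuous_fst.
apply: (@continuous_dprod _ _ XS (fun x k => (x.2 k).1)) => k.
exact: (continuous_after (@comp_dprod_continuous k) (@continuous_fst _ _)).
Qed.

Lemma act_continuous k : continuous (act k).
Proof.
exact: (continuous_after (@comp_dprod_continuous k) (@continuous_snd _ _)).
Qed.

Lemma signal_continuous k : continuous (fun w : MS => w.2 k).
Proof.
exact: (continuous_after (@continuous_snd Om (dprod _)) (@dprod_proj_continuous n Y k)).
Qed.

Lemma measurable_obs : measurable_fun setT (obs : borel XS -> borel MS).
Proof. by apply: continuous_borel; exact: obs_continuous. Qed.

Lemma measurable_act k : measurable_fun setT (act k : borel XS -> borel (U k)).
Proof. by apply: continuous_borel; exact: act_continuous. Qed.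

Lemma measurable_signal k :
  measurable_fun setT ((fun w => w.2 k) : borel MS -> borel (Y k)).
Proof. by apply: continuous_borel; exact: signal_continuous. Qed.

Lemma measurable_bigcap_ord d (T : measurableType d) (F : 'I_n -> set T) :
  (forall k, measurable (F k)) -> measurable (\bigcap_k F k).
Proof.
by move=> mF; apply: fin_bigcap_measurable => //; exact: finite_finset.
Qed.

Lemma measurable_rect (A : set (borel MS)) (C : forall k, set (borel (U k))) :
  measurable A -> (forall k, measurable (C k)) -> measurable (rect A C : set (borel XS)).
Proof.
move=> mA mC; rewrite rectE; apply: measurableI.
  by rewrite -[X in measurable X]setTI; exact: measurable_obs.
apply: measurable_bigcap_ord => k.
by rewrite -[X in measurable X]setTI; exact: measurable_act.
Qed.

Section rect_base.
Context {J : countType} {cM : J -> MS -> R} {cU : forall k, nat -> U k -> R}.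
Hypothesis cM_base : cozero_base cM.
Hypothesis cU_base : forall k, cozero_base (@cU k).

(** A factor for the exogenous variables times one factor per action: the cozero sets are then of
    the form [rect A C], the only sets on which [L_R] prescribes values. Finite functions keep the
    index type countable. *)
Definition cozero_rect (ja : J * {ffun 'I_n -> nat}) (x : XS) : R :=
  cM ja.1 (obs x) * \prod_k @cU k (ja.2 k) (act k x).

(** Rearranges coordinates; it inverts [x |-> (obs x, act x)], so the base of a plain product can be
    carried over to [XS]. *)
Let glue (wu : MS * dprod U) : XS := (wu.1.1, fun k => (wu.1.2 k, wu.2 k)).

Let glue_continuous : continuous glue.
Proof.
apply: (@continuous_pair (MS * dprod U)%type Om (dprod _)).
  exact: (continuous_after (@continuous_fst MS (dprod U)) (@continuous_fst Om (dprod Y))).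
apply: (@continuous_dprod _ _ (MS * dprod U)%type (fun wu k => (wu.1.2 k, wu.2 k))) => k.
apply: (@continuous_pair (MS * dprod U)%type (Y k) (U k)).
  exact: (continuous_after (@continuous_fst MS (dprod U)) (@signal_continuous k)).
exact: (continuous_after (@continuous_snd MS (dprod U)) (@dprod_proj_continuous n U k)).
Qed.

Lemma cozero_base_rect : cozero_base cozero_rect.
Proof.
have [cMc cM01 _] := cM_base; split.
- move=> [j a].
  have cj : continuous (fun x => cM j (obs x)).
    exact: (continuous_after obs_continuous (cMc j)).
  have ca : continuous (fun x : XS => \prod_k @cU k (a k) (act k x)).
    apply: (@continuous_prod _ XS _ _ (fun k x => @cU k (a k) (act k x))) => k.
    have [cc _ _] := cU_base k.
    exact: (continuous_after (@act_continuous k) (cc (a k))).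
  by move=> x; exact: (cvgM (cj x) (ca x)).
- move=> [j a] x; have /andP[m0 m1] := cM01 j (obs x).
  have u0 : 0 <= \prod_k @cU k (a k) (act k x).
    by apply: prodr_ge0 => k _; have [_ /(_ (a k) (act k x))/andP[]] := cU_base k.
  rewrite /cozero_rect mulr_ge0//= mulr_ile1//.
  by apply: prodr_ile1 => k _; have [_ /(_ (a k) (act k x))] := cU_base k.
- move=> V x oV Vx.
  have oG : open (glue @^-1` V) by move/continuousP : glue_continuous; apply.
  have glueK y : glue (obs y, fun k => act k y) = y.
    case: y => y1 y2; congr pair; apply/functional_extensionality_dep => k.
    by rewrite /= /act /=; case: (y2 k).
  have Gx : (glue @^-1` V) (obs x, fun k => act k x) by rewrite /preimage /mkset glueK.
  have [_ _ /(_ _ _ oG Gx)[[j a] [ja jaV]]] :=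
    cozero_base_prod cM_base (@cozero_base_dprod R n U (fun=> nat) (@cU) cU_base).
  exists (j, [ffun k => a k]).
  have E y : cozero_rect (j, [ffun k => a k]) y =
      cM j (obs y) * \prod_k @cU k (a k) (act k y).
    by congr (_ * _); apply: eq_bigr => k _; rewrite ffunE.
  split; first by rewrite E.
  move=> y; rewrite E => /(jaV (obs y, fun k => act k y)).
  by rewrite /preimage /mkset glueK.
Qed.

Lemma cozero_set_rect s : exists (A : set (borel MS)) (C : forall k, set (borel (U k))),
  [/\ measurable A, forall k, measurable (C k) & cozero_set cozero_rect s = rect A C].
Proof.
have [cMc cM01 _] := cM_base.
elim: s => [|[j a] s [A [C [mA mC sE]]]].
  exists setT, (fun=> setT); split => //.
  by apply/seteqP; split=> x // _; rewrite /cozero_set /= /cozero_prod big_nil.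
exists (A `&` [set w | 0 < cM j w]), (fun k => C k `&` [set u | 0 < @cU k (a k) u]).
split.
- apply: measurableI => //; apply: open_borel.
  have -> : [set w | 0 < cM j w] = cM j @^-1` `]0, +oo[ by rewrite preimage_itvoy.
  by move/continuousP : (cMc j); apply; exact: interval_open.
- move=> k; apply: measurableI => //; apply: open_borel.
  have [cc _ _] := cU_base k.
  have -> : [set u | 0 < @cU k (a k) u] = @cU k (a k) @^-1` `]0, +oo[.
    by rewrite preimage_itvoy.
  by move/continuousP : (cc (a k)); apply; exact: interval_open.
have c0 y : 0 <= cM j y by have /andP[] := cM01 j y.
have d0 k u : 0 <= @cU k (a k) u by have [_ /(_ (a k) u)/andP[]] := cU_base k.
have [_ r01 _] := cozero_base_rect.
have mul_gt0 (p q : R) : 0 <= p -> 0 <= q -> 0 < p * q <-> 0 < p /\ 0 < q.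
  move=> p0 q0; split=> [pq|[]]; last exact: mulr_gt0.
  by split; rewrite lt_def ?p0 ?q0 andbT; apply/eqP => z0; move: pq; rewrite z0 ?mulr0 ?mul0r ltxx.
have -> : cozero_set cozero_rect ((j, a) :: s) =
    [set x | 0 < cozero_rect (j, a) x] `&` cozero_set cozero_rect s.
  apply/seteqP; split=> x; rewrite /cozero_set /= /cozero_prod big_cons;
    rewrite mul_gt0//; try by have /andP[] := r01 (j, a) x.
  by apply: prodr_ge0 => i _; have /andP[] := r01 i x.
  by apply: prodr_ge0 => i _; have /andP[] := r01 i x.
rewrite sE; apply/seteqP; split=> x; rewrite /rect /cozero_rect /=.
  move=> [/(mul_gt0 _ _ (c0 _) (prodr_ge0 _ (fun k _ => d0 k _)))[cx dx] [Ax Cx]].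
  split; first by split.
  move=> k; split; first exact: Cx.
  rewrite lt_def d0 andbT; apply/eqP => z0; move: dx.
  by rewrite (bigD1 k)//= z0 mul0r ltxx.
move=> [[Ax cx] Cx]; split; last by split => // k; have [] := Cx k.
by apply: mulr_gt0 => //; apply: prodr_gt0 => k _; have [] := Cx k.
Qed.

(** The cozero sets of the rectangular base are rectangles and form a generating pi-system. *)
Lemma eq_probability_rect (P Q : probability (borel XS) R) :
  (forall (A : set (borel MS)) (C : forall k, set (borel (U k))),
    measurable A -> (forall k, measurable (C k)) -> P (rect A C) = Q (rect A C)) ->
  forall B, measurable B -> P B = Q B.
Proof.
move=> PQ B; rewrite (borel_cozero cozero_base_rect) => mB.
apply: (g_sigma_algebra_measure_unique (range (cozero_set cozero_rect)) _ (fun=> setT)) => //.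
- by move=> _ [s _ <-]; apply: cozero_set_measurable; exact: cozero_base_rect.
- by move=> _; exists [::] => //; apply/seteqP; split=> x // _; rewrite /cozero_set /= /cozero_prod big_nil.
- by rewrite bigcup_const//; exists 0%N.
- exact: cozero_setI cozero_base_rect.
- by move=> _ [s _ <-]; have [A [C [mA mC ->]]] := cozero_set_rect s; exact: PQ.
- by move=> k; apply: le_lt_trans (probability_le1 P measurableT) _; exact: ltry.
Qed.

Lemma measurable_into_XS d (Z : measurableType d) (f : Z -> borel XS) :
  (forall (A : set (borel MS)) (C : forall k, set (borel (U k))),
    measurable A -> (forall k, measurable (C k)) -> measurable (f @^-1` rect A C)) ->
  measurable_fun setT f.
Proof.
move=> mf; apply: (measurability _ (borel_cozero cozero_base_rect)).
move=> _ [_ [s _ <-] <-]; rewrite setTI.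
by have [A [C [mA mC ->]]] := cozero_set_rect s; exact: mf.
Qed.

End rect_base.
End team_space.

(** * Zero-one probabilities are Dirac masses *)

Section dirac_of_zero_one.
Context {R : realType} {T : ptopologicalType}.
Variable c : nat -> T -> R.
Hypothesis cb : cozero_base c.
Hypothesis hT : hausdorff_space T.

Definition cozero1 j : set (borel T) := [set x | 0 < c j x].

Lemma cozero1_measurable j : measurable (cozero1 j).
Proof.
have [cc _ _] := cb; apply: open_borel.
have -> : cozero1 j = c j @^-1` `]0, +oo[ by rewrite preimage_itvoy.
by move/continuousP : (cc j); apply; exact: interval_open.
Qed.

Lemma probability_setC0 d (S : measurableType d) (P : probability S R) A :
  measurable A -> P (~` A) = 0%E -> P A = 1%E.
Proof. by move=> mA A0; rewrite -[A]setCK probability_setC ?A0 ?sube0//; exact: measurableC. Qed.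

Lemma measure_bigcup_eq0 d (S : measurableType d) (P : probability S R) (F : nat -> set S) :
  (forall j, measurable (F j)) -> (forall j, P (F j) = 0%E) -> P (\bigcup_j F j) = 0%E.
Proof.
move=> mF F0; apply: measure_negligible; first exact: bigcup_measurable.
by apply: (@negligible_bigcup _ _ _ P F) => j; exists (F j); split => //; exact: F0.
Qed.

(** The null base sets have a null union, so some [x] avoids it. Each base set around [x] then has
    full mass, and so has their countable intersection, which is the singleton of [x] because [T] is
    Hausdorff. *)
Lemma dirac_of_zero_one (P : probability (borel T) R) :
  (forall j, P (cozero1 j) * P (~` cozero1 j) = 0)%E ->
  exists x : borel T, forall C, measurable C -> P C = \d_x C.
Proof.
move=> P01; have mc := cozero1_measurable; have [_ _ cbase] := cb.
have {}P01 j : P (cozero1 j) = 0%E \/ P (cozero1 j) = 1%E.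
  have /eqP := P01 j; rewrite mule_eq0 => /orP[/eqP|/eqP]; first by left.
  by move=> /(probability_setC0 (mc j)); right.
pose N : set (borel T) :=
  \bigcup_j (if pselect (P (cozero1 j) = 0%E) then cozero1 j else set0).
have N0 : P N = 0%E.
  apply: measure_bigcup_eq0 => j; case: pselect => j0.
  - exact: mc.
  - exact: measurable0.
  - exact: j0.
  - exact: measure0.
have [x Nx] : exists x, ~ N x.
  apply: contrapT => /forallNP H; have NT : N = setT.
    by apply/seteqP; split=> // x _; apply: contrapT; exact: H.
  by move: N0; rewrite NT probability_setT => /eqP; rewrite onee_eq0.
exists x.
pose F : set (borel T) := \bigcap_j (if pselect (cozero1 j x) then cozero1 j else setT).
have mF : measurable F.
  apply: bigcapT_measurable => j; case: pselect => xj; first exact: mc.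
  exact: measurableT.
have Fx : F = [set x].
  apply/seteqP; split=> y; last by move=> -> j _; case: pselect.
  move=> Fy; apply: contrapT => /eqP yx.
  have [|A [oA [xA yA]]] := @hausdorff_accessible T hT x y; first by rewrite eq_sym.
  have [j [jx jA]] := cbase A x oA (set_mem xA).
  apply: (set_mem yA); apply: jA.
  by have := Fy j I; case: pselect.
have PF : P F = 1%E.
  apply: probability_setC0 => //.
  rewrite /F setC_bigcap; apply: measure_bigcup_eq0 => j; case: pselect => xj.
  - by apply: measurableC; exact: mc.
  - by rewrite setCT.
  - have [j0|j1] := P01 j; last by rewrite probability_setC// j1 subee.
    by exfalso; apply: Nx; exists j => //; case: pselect.
  - by rewrite setCT measure0.
have P1 C : measurable C -> C x -> P C = 1%E.
  move=> mC Cx; apply/eqP; rewrite eq_le probability_le1//= -PF.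
  by apply: le_measure; rewrite ?inE// Fx => _ ->.
move=> C mC; rewrite diracE; have [xC|xC] := boolP (x \in C).
  by rewrite P1//; exact: set_mem.
have : P (~` C) = 1%E by apply: P1; [exact: measurableC|move=> /mem_set; exact/negP].
rewrite probability_setC// => /eqP.
have PCf : P C \is a fin_num by exact: fin_num_measure.
rewrite -(fineK PCf) -EFinB eqe => /eqP E; congr EFin; rewrite /=; lra.
Qed.

End dirac_of_zero_one.

(** * Deterministic policies among the randomized ones *)

Section deterministic_policies.
Context {R : realType} {n : nat} {Om : ptopologicalType}.
Context {Y U : 'I_n -> ptopologicalType}.

Local Notation MS := (MS Om Y).
Local Notation XS := (XS Om Y U).

(** The condition that defines [L_R], with the kernels as a parameter so that they can be
    modified. *)
Definition randomizes (mu : probability (borel MS) R)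
    (kappa : forall k, R.-pker borel (Y k) ~> borel (U k))
    (P : probability (borel XS) R) :=
  forall (A : set (borel MS)) (C : forall k, set (borel (U k))),
    measurable A -> (forall k, measurable (C k)) ->
    P (rect A C) = (\int[mu]_(w in A) \prod_(k < n) kappa k (w.2 k) (C k))%E.

Definition kprod (kappa : forall k, R.-pker borel (Y k) ~> borel (U k))
  (C : forall k, set (borel (U k))) (w : borel MS) : \bar R :=
  (\prod_(k < n) kappa k (w.2 k) (C k))%E.

Lemma measurable_eprod d (Z : measurableType d) (F : 'I_n -> Z -> \bar R) :
  (forall k, measurable_fun setT (F k)) ->
  measurable_fun setT (fun z => \prod_(k < n) F k z)%E.
Proof.
move=> mF; elim: (index_enum 'I_n) => [|k s IH].
  by under eq_fun do rewrite big_nil; exact: measurable_cst.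
by under eq_fun do rewrite big_cons; exact: emeasurable_funM.
Qed.

Lemma measurable_kernel_signal (kappa : forall k, R.-pker borel (Y k) ~> borel (U k)) k
    (C : set (borel (U k))) : measurable C ->
  measurable_fun setT (fun w : borel MS => kappa k (w.2 k) C).
Proof.
move=> mC.
exact: (measurableT_comp (measurable_kernel (kappa k) C mC) (@measurable_signal n Om Y k)).
Qed.

Lemma measurable_kprod kappa C : (forall k, measurable (C k)) ->
  measurable_fun setT (kprod kappa C).
Proof. by move=> mC; apply: measurable_eprod => k; exact: measurable_kernel_signal. Qed.

Lemma kprod_ge0 kappa C w : (0 <= kprod kappa C w)%E.
Proof. by apply: prode_ge0 => k _; exact: measure_ge0. Qed.

Variable mu : probability (borel MS) R.

Lemma strat_map_rect (g : team_policy Y U) (A : set MS) (C : forall k, set (U k)) :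
  strat_map (Om := Om) g @^-1` rect A C =
  A `&` \bigcap_k [set w : MS | C k (g k (w.2 k))].
Proof.
apply/seteqP; split=> -[w1 w2]; rewrite /strat_map /rect /=.
  by move=> [Aw Cw]; split => // k _; exact: Cw.
by move=> [Aw Cw]; split => // k; exact: Cw.
Qed.

Lemma measurable_policy_pre (g : team_policy Y U) k (C : set (borel (U k))) :
  measurable_policy g -> measurable C -> measurable ([set w | C (g k (w.2 k))] : set (borel MS)).
Proof.
move=> mg mC; rewrite -[X in measurable X]setTI.
exact: (measurableT_comp (mg k) (@measurable_signal n Om Y k)).
Qed.

Lemma prod_dirac (g : team_policy Y U) (C : forall k, set (borel (U k))) (w : MS) :
  (\prod_(k < n) \d_(g k (w.2 k) : borel (U k)) (C k))%E =
  (\1_(\bigcap_k [set w : MS | C k (g k (w.2 k))]) w)%:E :> \bar R.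
Proof.
rewrite indicE; have [wC|wC] := boolP (w \in _).
  rewrite big1// => k _; rewrite diracE mem_set//.
  by move: wC; rewrite inE => /(_ k I).
have [k nk] : exists k, ~ C k (g k (w.2 k)).
  apply: contrapT => /forallNP H; move: wC => /negP; apply; rewrite inE => k _.
  by apply: contrapT; exact: H.
by rewrite (bigD1 k)//= diracE memNset// mul0e.
Qed.

Lemma integral_prod_dirac (g : team_policy Y U) (A : set (borel MS))
    (C : forall k, set (borel (U k))) :
  measurable_policy g -> measurable A -> (forall k, measurable (C k)) ->
  (\int[mu]_(w in A) \prod_(k < n) \d_(g k (w.2 k) : borel (U k)) (C k) =
   mu (strat_map (Om := Om) g @^-1` rect A C))%E.
Proof.
move=> mg mA mC; under eq_integral do rewrite prod_dirac.
rewrite integral_indic// ?strat_map_rect 1?setIC//.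
by apply: measurable_bigcap_ord => k; exact: (measurable_policy_pre (C := C k) mg (mC k)).
Qed.

Lemma L_A_sub_L_R (P : probability (borel XS) R) : L_A mu P -> L_R mu P.
Proof.
move=> [g [mg gP]]; exists (fun k => kdirac (mg k)) => A C mA mC.
by rewrite gP ?integral_prod_dirac//; exact: measurable_rect.
Qed.

Section bases.
Context {J : countType} {cM : J -> MS -> R} {cU : forall k, nat -> U k -> R}.
Hypothesis cM_base : cozero_base cM.
Hypothesis cU_base : forall k, cozero_base (@cU k).

Lemma strategic_measure_exists (g : team_policy Y U) : measurable_policy g ->
  exists P : probability (borel XS) R, is_strategic mu g P.
Proof.
move=> mg; apply: (@pushforward_probability _ _ _ _ _ mu (strat_map g : borel MS -> borel XS)).
apply: (measurable_into_XS cM_base cU_base) => A C mA mC.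
rewrite strat_map_rect; apply: measurableI => //.
by apply: measurable_bigcap_ord => k; exact: (measurable_policy_pre (C := C k) mg (mC k)).
Qed.

Hypothesis hU : forall k, hausdorff_space (U k).

(** At a signal where the zero-one condition holds for all base sets the kernel is a Dirac mass, and
    its location is the action of the policy. The other signals are almost surely not observed and
    get the action [point]. *)
Lemma L_A_of_zero_one kappa (P : probability (borel XS) R) :
  randomizes mu kappa P ->
  (forall k j, {ae mu, forall w, kappa k (w.2 k) (cozero1 (@cU k) j) *
     kappa k (w.2 k) (~` cozero1 (@cU k) j) = 0}%E) ->
  L_A mu P.
Proof.
move=> kP k01.
have mc k j : measurable (cozero1 (@cU k) j) by apply: cozero1_measurable; exact: cU_base.
pose good k : set (borel (Y k)) := \bigcap_j [set y |
  kappa k y (cozero1 (@cU k) j) * kappa k y (~` cozero1 (@cU k) j) = 0]%E.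
have mgood k : measurable (good k).
  apply: bigcapT_measurable => j; rewrite -[X in measurable X]setTI.
  have m1 := measurable_kernel (kappa k) _ (mc k j).
  have m2 := measurable_kernel (kappa k) _ (measurableC (mc k j)).
  exact: (emeasurable_funM m1 m2 measurableT (emeasurable_set1 0)).
have dir k (y : Y k) : exists x : U k, good k y ->
    forall C : set (borel (U k)), measurable C -> kappa k y C = \d_(x : borel (U k)) C.
  have [gy|ngy] := pselect (good k y); last by exists point.
  have [Pk PkE] := @probability_of_set_function R _ (borel (U k)) (kappa k y)
    (measure0 _) (measure_ge0 _) (@measure_semi_sigma_additive _ _ _ (kappa k y))
    (@prob_kernel _ _ _ _ _ (kappa k) (y : borel (Y k))).
  have [|x xP] := @dirac_of_zero_one _ _ _ (cU_base k) (@hU k) Pk.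
    by move=> j; rewrite !PkE; exact: gy.
  by exists x => _ C mC; rewrite -PkE xP.
pose g k y := if pselect (good k y) then sval (cid (dir k y)) else point.
have gE k y : good k y -> forall C : set (borel (U k)), measurable C ->
    kappa k y C = \d_(g k y : borel (U k)) C.
  by move=> gy C mC; rewrite /g; case: pselect => // gy'; exact: (svalP (cid (dir k y))).
(* On [good k] the preimage of [C] is the set where [kappa k y C = 1], so measurability of the
   policy is inherited from the kernel. *)
have mg : measurable_policy g.
  move=> k _ C mC; rewrite setTI.
  have -> : g k @^-1` C = (good k `&` [set y | kappa k y C = 1%E]) `|`
      (~` good k `&` (if pselect (C point) then setT else set0)).
    apply/seteqP; split=> y; rewrite /preimage /=.
      move=> Cg; have [gy|ngy] := pselect (good k y).
        by left; split => //; rewrite gE// diracE mem_set.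
      right; split => //; move: Cg; rewrite /g; case: pselect => [//|ngy' Cp].
      by case: pselect.
    move=> [[gy]|[ngy]].
      rewrite gE// diracE; case: (boolP (_ \in _)) => [/set_mem//|_ /eqP].
      by rewrite eqe eq_sym oner_eq0.
    by rewrite /g; case: pselect => [//|ngy']; case: pselect.
  apply: measurableU; apply: measurableI => //.
  - rewrite -[X in measurable X]setTI.
    exact: (measurable_kernel (kappa k) C mC measurableT _ (emeasurable_set1 1)).
  - exact: measurableC.
  - by case: pselect => p; [exact: measurableT|exact: measurable0].
exists g; split => //.
have [P' P'E] := strategic_measure_exists mg.
move=> B mB; rewrite -P'E//.
apply: (eq_probability_rect cM_base cU_base) => // A C mA mC.
rewrite P'E; last exact: measurable_rect.
rewrite kP// -integral_prod_dirac//.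
apply: ae_eq_integral => //.
- exact: measurable_funS (measurable_kprod kappa mC).
- under eq_fun do rewrite prod_dirac.
  apply/measurable_EFinP; apply: measurable_indic.
  by apply: measurable_bigcap_ord => k; exact: (measurable_policy_pre (C := C k) mg (mC k)).
have : \forall w \ae mu, forall k, good k (w.2 k).
  pose E k j (w : borel MS) := (kappa k (w.2 k) (cozero1 (@cU k) j) *
     kappa k (w.2 k) (~` cozero1 (@cU k) j) = 0)%E.
  (* Agents are read as natural numbers, with [True] beyond [n], to put the quantifier in the
     countable form of [ae_foralln]. *)
  have : \forall w \ae mu, forall i, if insub i is Some k then forall j, E k j w else True.
    apply: ae_foralln => i; case: insubP => [k _ _|_]; last exact: aeW.
    by apply: ae_foralln => j; exact: k01.
  apply: filterS => w gw k j _.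
  by have := gw k; rewrite valK; apply.
apply: (@filterS _ _ (ae_filter_ringOfSetsType mu)) => w gw _.
by apply: eq_bigr => k _; exact: gE.
Qed.

End bases.
End deterministic_policies.

(** * Tilting the kernel of one agent *)

Section tilted_kernel.
Context {R : realType} d d' (X : measurableType d) (Y : measurableType d').
Variables (k : R.-pker X ~> Y) (B : set Y).
Hypothesis mB : measurable B.
Local Open Scope ereal_scope.

Lemma pker_fin_num x C : measurable C -> k x C \is a fin_num.
Proof.
move=> mC; rewrite ge0_fin_numE//; apply: le_lt_trans (ltry 1).
by rewrite -(@prob_kernel _ _ _ _ _ k x) le_measure// inE.
Qed.

Lemma pker_setC x : k x B + k x (~` B) = 1.
Proof.
have mC := measurableC mB.
rewrite -(measureU (k x) mB mC (setICr B)) setUv; exact: prob_kernel.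
Qed.

Let weight_ge0 x : (0 <= fine (k x (~` B)))%R.
Proof. by rewrite fine_ge0. Qed.

Definition tilted_kernel (x : X) : {measure set Y -> \bar R} :=
  measure_add (mrestr (k x) mB) (mscale (NngNum (weight_ge0 x)) (k x)).

Lemma tilted_kernelE x C :
  tilted_kernel x C = k x (C `&` B) + k x (~` B) * k x C.
Proof.
transitivity (mrestr (k x) mB C + mscale (NngNum (weight_ge0 x)) (k x) C).
  exact: measure_addE.
by rewrite /mrestr /mscale /= fineK//; apply: pker_fin_num; exact: measurableC.
Qed.

Let measurable_tilted C : measurable C -> measurable_fun setT (tilted_kernel ^~ C).
Proof.
move=> mC; under eq_fun do rewrite tilted_kernelE.
apply: emeasurable_funD; first by apply: measurable_kernel; exact: measurableI.
apply: emeasurable_funM; apply: measurable_kernel => //; exact: measurableC.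
Qed.

HB.instance Definition _ := isKernel.Build _ _ X Y R tilted_kernel measurable_tilted.

Let tilted_setT x : tilted_kernel x setT = 1.
Proof. by rewrite tilted_kernelE setTI prob_kernel mule1 pker_setC. Qed.

HB.instance Definition _ := Kernel_isProbability.Build _ _ X Y R tilted_kernel tilted_setT.

Lemma tilted_kernel_exists : exists k' : R.-pker X ~> Y, forall x C,
  k' x C = k x (C `&` B) + k x (~` B) * k x C.
Proof. by exists tilted_kernel => x C; exact: tilted_kernelE. Qed.

End tilted_kernel.

Section splitting.
Context {R : realType} {n : nat} {Om : ptopologicalType}.
Context {Y U : 'I_n -> ptopologicalType}.

Local Notation MS := (MS Om Y).
Local Notation XS := (XS Om Y U).

Local Open Scope ereal_scope.
Variables (mu : probability (borel MS) R).
Variables (kappa : forall k, R.-pker borel (Y k) ~> borel (U k)).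
Lemma kprod_fin_num (C : forall k, set (borel (U k))) (w : borel MS) :
  (forall k, measurable (C k)) -> kprod kappa C w \is a fin_num.
Proof. by move=> mC; apply: prode_fin_num => k _; exact: pker_fin_num. Qed.

Variables (P : probability (borel XS) R).
Hypothesis kP : randomizes mu kappa P.

(** For [h] the indicator of a set, [A] merely shrinks to its intersection with that set and the
    identity is [kP]; the rest is [nonneg_measurable_ind]. This allows densities that depend on the
    kernels. *)
Lemma integral_rect (A : set (borel MS)) (C : forall k, set (borel (U k)))
    (h : borel MS -> \bar R) :
  measurable A -> (forall k, measurable (C k)) ->
  measurable_fun setT h -> (forall w, 0 <= h w) ->
  \int[P]_(x in rect A C) h (obs x) = \int[mu]_(w in A) (h w * kprod kappa C w).
Proof.
move=> mA mC; have mr := measurable_rect mA mC.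
have mK : measurable_fun A (kprod kappa C).
  exact: measurable_funS (measurable_kprod kappa mC).
have mobs (f : borel MS -> \bar R) : measurable_fun setT f ->
    measurable_fun (rect A C : set (borel XS)) (fun x => f (obs x)).
  move=> mf; apply: measurable_funS (measurableT_comp mf measurable_obs) => //.
have mon (f : borel MS -> \bar R) : measurable_fun setT f -> measurable_fun A f.
  by move=> mf; exact: measurable_funS mf.
have K0 w : 0 <= kprod kappa C w by exact: kprod_ge0.
move: h; apply: (@nonneg_measurable_ind R _ (borel MS) (fun h : borel MS -> \bar R =>
  \int[P]_(x in rect A C) h (obs x) = \int[mu]_(w in A) (h w * kprod kappa C w))).
- move=> A' mA'; under eq_integral.
    move=> x _; rewrite -[\1_A' _]/(\1_(obs @^-1` A') x); over.
  rewrite integral_indic//; last first.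
    by rewrite -[X in measurable X]setTI; exact: measurable_obs.
  have -> : obs @^-1` A' `&` rect A C = rect (A `&` A') C.
    by apply/seteqP; split=> x [] => [A'x [Ax Cx]|[Ax A'x] Cx].
  transitivity (\int[mu]_(w in A `&` A') kprod kappa C w).
    by apply: kP => //; exact: measurableI.
  rewrite integral_mkcondr; apply: eq_integral => w _.
  by rewrite patchE indicE; case: ifPn; rewrite ?mul1e ?mul0e.
- move=> r f r0 mf f0 E.
  rewrite ge0_integralZl_EFin//; last exact: mobs.
  rewrite E -ge0_integralZl_EFin//.
  + by apply: eq_integral => w _; rewrite muleA.
  + by move=> w _; exact: mule_ge0.
  + by apply: emeasurable_funM => //; exact: mon.
- move=> f g mf mg f0 g0 Ef Eg.
  rewrite ge0_integralD//; [|exact: mobs..].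
  rewrite Ef Eg -ge0_integralD//.
  + by apply: eq_integral => w _; rewrite ge0_muleDl.
  + by move=> w _; exact: mule_ge0.
  + by apply: emeasurable_funM => //; exact: mon.
  + by move=> w _; exact: mule_ge0.
  + by apply: emeasurable_funM => //; exact: mon.
- move=> f mf f0 ndf IH.
  rewrite monotone_convergence//; try by [move=> m; exact: mobs|move=> x _ i j ij; exact: ndf].
  transitivity (limn (fun m => \int[mu]_(w in A) (f m w * kprod kappa C w))).
    by congr (limn _); apply/funext => m; exact: IH.
  rewrite -monotone_convergence//.
  + apply: eq_integral => w _; apply/cvg_lim => //.
    apply: cvgeZr; first exact: kprod_fin_num.
    by apply: ereal_nondecreasing_is_cvgn => i j ij; exact: ndf.
  + by move=> m; apply: emeasurable_funM => //; exact: mon.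
  + by move=> m w _; exact: mule_ge0.
  + by move=> w _ i j ij; apply: lee_wpmul2r => //; exact: ndf.
Qed.

End splitting.

(** * Elements of [L_R] that are not midpoints *)

Section extreme_points.
Context {R : realType} {n : nat} {Om : ptopologicalType}.
Context {Y U : 'I_n -> ptopologicalType}.

Local Notation MS := (MS Om Y).
Local Notation XS := (XS Om Y U).
Local Open Scope ereal_scope.

Variables (mu : probability (borel MS) R).

Section tilt.
Variables (kappa : forall k, R.-pker borel (Y k) ~> borel (U k)).
Variables (P : probability (borel XS) R).
Hypothesis kP : randomizes mu kappa P.
Variables (k0 : 'I_n) (B : set (borel (U k0))).
Hypothesis mB : measurable B.

Definition miss (w : borel MS) : \bar R := kappa k0 (w.2 k0) (~` B).

Definition act_set : set (borel XS) := act k0 @^-1` B.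

Lemma measurable_act_set : measurable act_set.
Proof. by rewrite -[X in measurable X]setTI; exact: measurable_act. Qed.

Let mmiss : measurable_fun setT miss.
Proof. by apply: measurable_kernel_signal; exact: measurableC. Qed.

Let miss_ge0 w : 0 <= miss w.
Proof. exact: measure_ge0. Qed.

Let mmiss_obs (S : set (borel XS)) : measurable_fun S (miss \o obs).
Proof. exact: measurable_funS (measurableT_comp mmiss measurable_obs). Qed.

Definition cut_at (C : forall k, set (borel (U k))) : forall k, set (borel (U k)) :=
  dfwith C k0 (C k0 `&` B).

Lemma measurable_cut_at C k : (forall k, measurable (C k)) -> measurable (@cut_at C k).
Proof. by move=> mC; rewrite /cut_at; case: dfwithP => [|j _] //; exact: measurableI. Qed.

Lemma rect_cut_at A C : rect A C `&` act_set = rect A (cut_at C) :> set XS.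
Proof.
apply/seteqP; split=> x.
  move=> [[Ax Cx] Bx]; split => // k; rewrite /cut_at.
  by case: dfwithP => [|j _] //; split => //; exact: Cx.
move=> [Ax Cx]; split; last by have := Cx k0; rewrite /cut_at dfwithin => -[].
split => // k; have := Cx k; rewrite /cut_at.
by case: dfwithP => [[]|j _].
Qed.

(** Tilting the kernel of agent [k0] gives [P] the density [\1_act_set + miss \o obs], which is used
    to define [Q]. It lies in [L_R] because [act_set] cuts a rectangle to a rectangle and
    [integral_rect] brings [miss] next to the kernel product. *)
Lemma tilt_exists : exists Q : probability (borel XS) R, L_R mu Q /\
  forall S, measurable S -> Q S = P (S `&` act_set) + \int[P]_(x in S) miss (obs x).
Proof.
have [k' k'E] := tilted_kernel_exists (kappa k0) mB.
pose kappa' : forall k, R.-pker borel (Y k) ~> borel (U k) := dfwith kappa k0 k'.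
have kprodE C w : kprod kappa' C w = kprod kappa (cut_at C) w + miss w * kprod kappa C w.
  rewrite /kprod (bigD1 k0)//= [X in _ = X + _](bigD1 k0)//=.
  rewrite [X in _ = _ + _ * X](bigD1 k0)//=.
  rewrite /kappa' /cut_at !dfwithin k'E.
  set p := \prod_(i < n | i != k0) _; set q := \prod_(i < n | i != k0) _.
  set r := \prod_(i < n | i != k0) _.
  have pr : p = r by apply: eq_bigr => i ik; rewrite dfwithout// eq_sym.
  have qr : q = r by apply: eq_bigr => i ik; rewrite dfwithout// eq_sym.
  by rewrite pr qr ge0_muleDl ?mule_ge0 ?measure_ge0// muleA.
pose dens x : \bar R := (\1_act_set x)%:E + miss (obs x).
have m1 (S : set (borel XS)) : measurable_fun S (EFin \o \1_act_set : _ -> \bar R).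
  apply/measurable_EFinP; apply: measurable_indic; exact: measurable_act_set.
have mdens S : measurable_fun S dens by apply: emeasurable_funD.
have dens_ge0 x : 0 <= dens x by rewrite adde_ge0// lee_fin indicE.
pose f S := \int[P]_(x in S) dens x.
have fE S : measurable S -> f S = P (S `&` act_set) + \int[P]_(x in S) miss (obs x).
  move=> mS; rewrite /f ge0_integralD//.
  congr (_ + _); rewrite setIC; apply: integral_indic => //.
  exact: measurable_act_set.
have f_rect (A : set (borel MS)) (C : forall k, set (borel (U k))) :
    measurable A -> (forall k, measurable (C k)) ->
    f (rect A C) = \int[mu]_(w in A) kprod kappa' C w.
  move=> mA mC; rewrite fE; last exact: measurable_rect.
  rewrite (integral_rect kP)// rect_cut_at.
  transitivity (\int[mu]_(w in A) kprod kappa (cut_at C) w +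
      \int[mu]_(w in A) (miss w * kprod kappa C w)).
    by congr (_ + _); apply: kP => // k; exact: measurable_cut_at.
  have mK C' : (forall k, measurable (C' k)) -> measurable_fun A (kprod kappa C').
    by move=> mC'; exact: measurable_funS (measurable_kprod kappa mC').
  rewrite -ge0_integralD//.
  - by apply: eq_integral => w _; rewrite kprodE.
  - by move=> w _; exact: kprod_ge0.
  - by apply: mK => k; exact: measurable_cut_at.
  - by move=> w _; rewrite mule_ge0// kprod_ge0.
  - apply: emeasurable_funM; last exact: mK.
    exact: measurable_funS mmiss.
have f1 : f setT = 1.
  have -> : setT = rect setT (fun=> setT) :> set XS by apply/seteqP; split.
  rewrite f_rect//; under eq_integral.
    move=> w _; rewrite /kprod big1; last by move=> k _; exact: prob_kernel.
    over.
  by rewrite integral_cst// mul1e; exact: probability_setT.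
have f_add : semi_sigma_additive f.
  move=> F mF tF mUF; rewrite /f ge0_integral_bigcup//.
  by apply: is_cvg_ereal_nneg_natsum => i _; exact: integral_ge0.
have [Q QE] := @probability_of_set_function R _ (borel XS) f
  (integral_set0 _ _) (fun S => integral_ge0 _ (fun x _ => dens_ge0 x)) f_add f1.
exists Q; split; last by move=> S mS; rewrite QE fE.
by exists kappa' => A C mA mC; rewrite QE f_rect.
Qed.

End tilt.

(** The tilts at [B] and at its complement average to [P]: the kept parts add up to [P], and so do
    the redrawn parts. If the two tilts coincide, the kernel almost surely charges only one of [B]
    and its complement; with [B] running through the base, [L_A_of_zero_one] applies. *)
Lemma L_A_of_no_midpoint {J : countType} {cM : J -> MS -> R} {cU : forall k, nat -> U k -> R}
    (P : probability (borel XS) R) :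
  cozero_base cM -> (forall k, cozero_base (@cU k)) -> (forall k, hausdorff_space (U k)) ->
  L_R mu P ->
  (forall Q1 Q2 : probability (borel XS) R, L_R mu Q1 -> L_R mu Q2 ->
    (forall S, measurable S -> P S + P S = Q1 S + Q2 S) ->
    forall S, measurable S -> Q1 S = Q2 S) ->
  L_A mu P.
Proof.
move=> cMb cUb hU [kappa kP] nomid.
apply: (L_A_of_zero_one cMb cUb hU kP) => k j.
have mB : measurable (cozero1 (@cU k) j) by apply: cozero1_measurable; exact: cUb.
move: (cozero1 (@cU k) j) mB => B mB; have mC := measurableC mB.
have [Q1 [Q1R Q1E]] := tilt_exists kP mB.
have [Q2 [Q2R Q2E]] := tilt_exists kP mC.
have mact := measurable_act_set mB.
have mmiss (D : set (borel (U k))) : measurable D -> measurable_fun setT (miss kappa D).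
  by move=> mD; apply: measurable_kernel_signal; exact: measurableC.
have mobs (S : set (borel XS)) (D : set (borel (U k))) : measurable D ->
    measurable_fun S (miss kappa D \o obs).
  by move=> mD; exact: measurable_funS (measurableT_comp (mmiss _ mD) measurable_obs).
have miss_ge0 (D : set (borel (U k))) (w : borel MS) : 0 <= miss kappa D w by exact: measure_ge0.
have miss1 (w : borel MS) : miss kappa (~` B) w + miss kappa B w = 1.
  by rewrite /miss setCK; exact: pker_setC.
have sumQ S : measurable S -> P S + P S = Q1 S + Q2 S.
  move=> mS; rewrite Q1E// Q2E// addeACA; congr (_ + _).
    by rewrite addeC -(measureDI P mS mact).
  rewrite addeC -ge0_integralD//; try by [exact: mobs|move=> x _; exact: miss_ge0].
  under eq_integral do rewrite miss1.
  by rewrite integral_cst// mul1e.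
(* Both tilts are evaluated on the event that agent [k] acts in [B]. With [p] and [q] the
   conditional probabilities of [B] and of its complement, this reads
   [\int p + \int q * p = \int p * p]; since [p = p * p + q * p], the integral of [q * p]
   vanishes. *)
have := nomid _ _ Q1R Q2R sumQ _ mact; rewrite Q1E// Q2E//.
pose C : forall k, set (borel (U k)) := cut_at (k0 := k) B (fun=> setT).
have mCC i : measurable (C i) by exact: measurable_cut_at.
have actE : act_set B = rect setT C :> set XS.
  by rewrite -rect_cut_at; apply/seteqP; split=> x; [split|case].
have KC w : kprod kappa C w = miss kappa (~` B) w.
  rewrite /kprod (bigD1 k)//= {1}/C /cut_at dfwithin setTI big1 ?mule1 ?/miss ?setCK//.
  by move=> i ik; rewrite /C /cut_at dfwithout 1?eq_sym//; exact: prob_kernel.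
have PB : P (act_set B) = \int[mu]_w miss kappa (~` B) w.
  rewrite actE; transitivity (\int[mu]_w kprod kappa C w); first exact: kP.
  by apply: eq_integral => w _; exact: KC.
have IB (D : set (borel (U k))) : measurable D -> \int[P]_(x in act_set B) miss kappa D (obs x) =
    \int[mu]_w (miss kappa D w * miss kappa (~` B) w).
  move=> mD; rewrite actE (integral_rect kP measurableT mCC (mmiss _ mD) (miss_ge0 D)).
  by apply: eq_integral => w _; rewrite KC.
rewrite setIid (IB _ mB) (IB _ mC) PB.
have -> : act_set B `&` act_set (~` B) = set0 by rewrite /act_set preimage_setC setICr.
rewrite measure0 add0e.
set q := miss kappa B; set p := miss kappa (~` B).
have mq : measurable_fun setT q by exact: mmiss.
have mp : measurable_fun setT p by exact: mmiss.
have mpp : measurable_fun setT (fun w => p w * p w) by exact: emeasurable_funM.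
have mqp : measurable_fun setT (fun w => q w * p w) by exact: emeasurable_funM.
have -> : \int[mu]_w p w = \int[mu]_w (p w * p w) + \int[mu]_w (q w * p w).
  rewrite -ge0_integralD//; try by move=> w _; exact: mule_ge0.
  by apply: eq_integral => w _; rewrite -ge0_muleDl// miss1 mul1e.
have le1 (w : borel MS) (D : set (borel (U k))) : measurable D -> miss kappa D w <= 1.
  move=> mD; rewrite -(prob_kernel (w.2 k : borel (Y k)) (s := kappa k)).
  by apply: le_measure; rewrite ?inE//; exact: measurableC.
have fin : \int[mu]_w (p w * p w) \is a fin_num.
  rewrite ge0_fin_numE; last by apply: integral_ge0 => w _; exact: mule_ge0.
  apply: (@le_lt_trans _ _ (\int[mu]_w cst 1 w)).
    apply: ge0_le_integral => //; try by move=> w _; exact: mule_ge0.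
    by move=> w _; rewrite -[leRHS]mule1; apply: lee_pmul => //; exact: le1.
  rewrite integral_cst// mul1e; apply: le_lt_trans (probability_le1 mu measurableT) _.
  exact: ltry.
rewrite -addeA => /(congr1 (fun z => z - \int[mu]_w (p w * p w))).
rewrite addeAC subee// add0e => /eqP.
have qp0 : 0 <= \int[mu]_w (q w * p w) by apply: integral_ge0 => w _; exact: mule_ge0.
rewrite padde_eq0// => /andP[/eqP I0 _].
have /ae_eq_integral_abs : \int[mu]_w `|q w * p w| = 0.
  by rewrite -I0; apply: eq_integral => w _; rewrite gee0_abs// mule_ge0.
move=> /(_ measurableT mqp); apply: (@filterS _ _ (ae_filter_ringOfSetsType mu)) => w /(_ I).
by rewrite /q /p /miss setCK muleC.
Qed.

End extreme_points.

(** * The weak topology through its integrals *)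

Section weak_topology.
Context {R : realType} {X : ptopologicalType}.

Lemma prob_integral_continuous (g : bcfun R X) :
  continuous (fun P : weakP R X => prob_integral P g : R).
Proof.
have c1 : continuous (@prob_integral R X : weakP R X -> {ptws bcfun R X -> R}).
  exact: initial_continuous.
have c2 : continuous (fun u : {ptws bcfun R X -> R} => u g).
  move=> u V; rewrite nbhsE => -[V' [oV' V'u] V'V].
  have /cvg_sup/(_ g) : nbhs u --> u by exact: cvg_id.
  apply; rewrite (@nbhsE (initial_topology _)).
  exists ((fun u : {ptws bcfun R X -> R} => u g) @^-1` V') => [|v /V'V//].
  by split => //; exists V'.
by move=> P; exact: (continuous_comp (c1 P) (c2 _)).
Qed.

Lemma cvg_weakP (F : set_system (weakP R X)) (P : weakP R X) : Filter F ->
  (forall g : bcfun R X, (prob_integral Q g : R) @[Q --> F] --> (prob_integral P g : R)) ->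
  F --> P.
Proof.
move=> FF cv A; rewrite (@nbhsE (initial_topology _)) => -[_ [[V oV <-] VP] VA].
apply: filterS VA _.
have : (@prob_integral R X : weakP R X -> {ptws bcfun R X -> R}) @ F --> prob_integral P.
  apply/cvg_sup => g B; rewrite (@nbhsE (initial_topology _)) => -[_ [[B' oB' <-] Bg] BB].
  apply: filterS BB _; apply: (cv g); exact: open_nbhs_nbhs.
by apply; exact: open_nbhs_nbhs.
Qed.

(** Open sets are preimages under [prob_integral], so they cannot tell apart elements with equal
    integrals. *)
Lemma weakP_indistinguishable (P Q : weakP R X) (V : set (weakP R X)) :
  open V -> V P -> (forall g : bcfun R X, prob_integral P g = prob_integral Q g :> R) -> V Q.
Proof.
move=> [V' oV' <-] /= VP PQ; have -> // : prob_integral Q = prob_integral P.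
by apply/funext => g.
Qed.

Lemma eq_prob_integral (P Q : probability (borel X) R) (g : bcfun R X) :
  (forall B, measurable B -> P B = Q B) -> prob_integral P g = prob_integral Q g :> R.
Proof.
by move=> PQ; congr fine; apply: eq_measure_integral => A mA _; exact: PQ.
Qed.

Lemma cst_bc (c : R) : continuous (fun _ : X => c) /\
  exists M : R, forall x : X, `|(fun _ : X => c) x| <= M.
Proof. by split; [move=> x; exact: cvg_cst|exists `|c|]. Qed.

Definition cst_bcfun c : bcfun R X := exist _ _ (cst_bc c).

Lemma add_bc (f g : bcfun R X) : continuous (fun x => sval f x + sval g x) /\
  exists M : R, forall x, `|sval f x + sval g x| <= M.
Proof.
have [cf [M fM]] := svalP f; have [cg [N gN]] := svalP g; split.
  by move=> x; apply: cvgD; [exact: cf|exact: cg].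
by exists (M + N) => x; rewrite (le_trans (ler_normD _ _))// lerD.
Qed.

Definition add_bcfun f g : bcfun R X := exist _ _ (add_bc f g).

Lemma scale_bc (c : R) (f : bcfun R X) : continuous (fun x => c * sval f x) /\
  exists M : R, forall x, `|c * sval f x| <= M.
Proof.
have [cf [M fM]] := svalP f; split.
  by move=> x; apply: cvgM; [exact: cvg_cst|exact: cf].
by exists (`|c| * M) => x; rewrite normrM ler_wpM2l.
Qed.

Definition scale_bcfun c f : bcfun R X := exist _ _ (scale_bc c f).

Lemma prob_integral_cst (P : probability (borel X) R) c :
  prob_integral P (cst_bcfun c) = c :> R.
Proof.
rewrite /prob_integral /=; have -> // : (\int[P]_x c%:E)%E = c%:E.
transitivity (c%:E * P setT)%E; first exact: (integral_cst P measurableT c%:E).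
by rewrite -[RHS]mule1; congr (_ * _)%E; exact: probability_setT.
Qed.

Lemma prob_integralD (P : probability (borel X) R) f g :
  prob_integral P (add_bcfun f g) = prob_integral P f + prob_integral P g :> R.
Proof.
apply: EFin_inj; rewrite -prob_integralE EFinD -!prob_integralE /=.
rewrite -(integralD measurableT (bcfun_integrable P f) (bcfun_integrable P g)).
by apply: eq_integral => x _; rewrite EFinD.
Qed.

Lemma prob_integralZ (P : probability (borel X) R) c f :
  prob_integral P (scale_bcfun c f) = c * prob_integral P f :> R.
Proof.
apply: EFin_inj; rewrite -prob_integralE EFinM -!prob_integralE /=.
rewrite -(integralZl measurableT (bcfun_integrable P f)).
by apply: eq_integral => x _; rewrite EFinM.
Qed.

Lemma prob_integral_norm_le (P : probability (borel X) R) (f : bcfun R X) (M : R) :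
  (forall x, `|sval f x| <= M) -> `|prob_integral P f| <= M.
Proof.
move=> fM.
have leM (g : bcfun R X) c : (forall x, sval g x <= c) -> prob_integral P g <= c :> R.
  move=> gc; rewrite -[leRHS](prob_integral_cst P) -lee_fin -!prob_integralE.
  apply: le_integral; [exact: measurableT|exact: bcfun_integrable|exact: bcfun_integrable|].
  by move=> x _; rewrite lee_fin; exact: gc.
rewrite ler_norml; apply/andP; split; last first.
  by apply: leM => x; have := fM x; rewrite ler_norml => /andP[].
rewrite lerNl -mulN1r -prob_integralZ; apply: leM => x /=.
by rewrite mulN1r; have := fM x; rewrite ler_norml lerNl => /andP[].
Qed.

End weak_topology.

(** * Measurability of maps into a compact set *)

Section measurable_into_compact.
Context {R : realType} {T : topologicalType}.
Variables (K : set T) (f : nat -> T -> R).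
Hypothesis cK : compact K.
Hypothesis fc : forall i, continuous (f i).

(** Points outside [V] that agree with [p] on the first [m] cuts would cluster, as [m] grows, at a
    point with the same values of the family as [p]. That point lies in [V], which is open. *)
Lemma cuts_isolate (V : set T) p : open V -> K p ->
  (forall x, K x -> (forall i, f i p = f i x) -> V x) ->
  exists m, forall x, K x -> (forall j, (j < m)%N -> cut f j x <-> cut f j p) -> V x.
Proof.
move=> oV Kp Vsat; apply: contrapT => /forallNP H.
have {H} H m : exists x, [/\ K x, (forall j, (j < m)%N -> cut f j x <-> cut f j p) & ~ V x].
  apply: contrapT => /forallNP Hm; apply: (H m) => x Kx xp.
  by apply: contrapT => nVx; apply: (Hm x).
have [u uP] := choice H.
have [|x [Kx xcl]] := cK (F := u @ \oo) _.
  by exists 0%N => // m _; have [] := uP m.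
have often (B : set T) N : nbhs x B -> exists2 m, (N <= m)%N & B (u m).
  move=> nB; have [|_ [[m /= Nm <-]]] := xcl (u @` [set m | (N <= m)%N]) B _ nB.
    by exists N => // m /= Nm; exists m.
  by exists m.
have fpx i : f i p = f i x.
  apply/eqP; rewrite eq_le !leNgt; apply/andP; split; apply/negP.
    move=> /rat_in_itvoo[q]; rewrite in_itv /= => /andP[xq qp].
    have [|m Nm um] := often [set z | f i z < ratr q] (pickle (i, q)).+1.
      exact: (cvgr_lt _ (@fc i x)).
    have [_ /(_ _ Nm)] := uP m; rewrite cutE /= => up _.
    by have := lt_trans (up.2 qp) um; rewrite ltxx.
  move=> /rat_in_itvoo[q]; rewrite in_itv /= => /andP[pq qx].
  have [|m Nm um] := often [set z | ratr q < f i z] (pickle (i, q)).+1.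
    exact: (cvgr_gt _ (@fc i x)).
  have [_ /(_ _ Nm)] := uP m; rewrite cutE /= => up _.
  by have := lt_trans (up.1 um) pq; rewrite ltxx.
have [|m _ Vm] := often V 0%N.
  by apply: open_nbhs_nbhs; split => //; exact: Vsat.
by have [] := uP m.
Qed.

(** The open sets of [T] have no countable base at hand. Cells given by finitely many cuts are
    countably many, though, and by [cuts_isolate] those mapped into [V] cover the preimage. *)
Lemma measurable_preimage_open d (Z : measurableType d) (D : set Z) (psi : Z -> T)
    (V : set T) : measurable D -> (forall z, D z -> K (psi z)) ->
  (forall i, measurable_fun D (f i \o psi)) -> open V ->
  (forall x y, K x -> K y -> V x -> (forall i, f i x = f i y) -> V y) ->
  measurable (D `&` psi @^-1` V).
Proof.
move=> mD DK mf oV Vsat.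
have mcut j : measurable (D `&` psi @^-1` (cut f j)).
  rewrite /cut; case: unpickle => [[i q]|]; last by rewrite preimage_set0 setI0.
  have := mf i mD `]ratr q, +oo[%classic (measurable_itv _).
  by congr (measurable (_ `&` _)); apply/seteqP; split=> z /=; rewrite in_itv /= andbT.
pose cell (s : seq bool) : set Z := [set z | D z /\
  forall j, (j < size s)%N -> cut f j (psi z) <-> nth false s j].
have mcell s : measurable (cell s).
  have -> : cell s = D `&` \bigcap_(j in [set j | (j < size s)%N])
      (if nth false s j then D `&` psi @^-1` cut f j else D `\` (D `&` psi @^-1` cut f j)).
    apply/seteqP; split=> z.
      move=> [Dz cz]; split => // j js; have := cz j js.
      case: (nth false s j) => cj; first by split => //; exact/cj.
      by split => // -[_ /cj].
    move=> [Dz cz]; split => // j js; have := cz j js.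
    case: (nth false s j) => [[_ cj]|[_ cj]]; first by split.
    by split => // cutj; exfalso; apply: cj.
  apply: measurableI => //; apply: bigcap_measurableType => j _.
  by case: (nth false s j) => //; exact: measurableD.
pose good s := cell s `<=` psi @^-1` V.
have -> : D `&` psi @^-1` V = \bigcup_k
    (if unpickle k is Some s then (if pselect (good s) then cell s else set0) else set0).
  apply/seteqP; split=> [z [Dz Vz]|z [k _]]; last first.
    case: unpickle => // s; case: pselect => [gs cz|ngs []].
    by split; [have [] := cz|exact: (gs z cz)].
  have [m mP] := cuts_isolate oV (DK z Dz) (fun x Kx px => Vsat _ _ (DK z Dz) Kx Vz px).
  pose s := mkseq (fun j => `[< cut f j (psi z) >]) m.
  have gs : good s.
    move=> y [Dy cy]; apply: mP; first exact: DK.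
    move=> j jm; have := cy j; rewrite size_mkseq nth_mkseq// => /(_ jm) ->.
    by split => /asboolP.
  exists (pickle s) => //; rewrite pickleK; case: pselect => [gs'|ngs]; last by [].
  split => // j; rewrite size_mkseq => jm; rewrite nth_mkseq//.
  by split => /asboolP.
apply: bigcup_measurable => k _ /=.
by case: pselect => gs; [exact: mcell|exact: measurable0].
Qed.

End measurable_into_compact.

Lemma ultra_bounded_cvg {R : realType} (T : Type) (F : set_system T) (h : T -> R) (M : R) :
  UltraFilter F -> (forall x, `|h x| <= M) -> exists l : R, h x @[x --> F] --> l.
Proof.
move=> UF hM; have [|l [_ lcl]] := @segment_compact R (- M) M (h x @[x --> F]) _.
  suff : F (h @^-1` `[- M, M]%classic) by [].
  by apply: filterE => x; rewrite /= in_itv /=; have := hM x; rewrite ler_norml.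
exists l => B nB; have [//|FnB] := in_ultra_setVsetC (h @^-1` B) UF.
by have [y [nBy By]] := lcl (~` B) B FnB nB.
Qed.

Lemma cozero_base_reindex {R : realType} (X : topologicalType) (I J : Type)
    (c : I -> X -> R) (h : J -> I) :
  cozero_base c -> (forall i, exists j, forall x, c (h j) x = c i x) ->
  cozero_base (fun j => c (h j)).
Proof.
move=> [cc c01 cb] hsurj; split => [j|j x|V x oV Vx]; [exact: cc|exact: c01|].
have [i [ci iV]] := cb V x oV Vx; have [j jE] := hsurj i.
by exists j; rewrite jE; split => // y; rewrite jE; exact: iV.
Qed.

Lemma prob_integral_midpoint {R : realType} (X : ptopologicalType)
    (P Q1 Q2 : probability (borel X) R) (g : bcfun R X) :
  (forall S, measurable S -> P S + P S = Q1 S + Q2 S)%E ->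
  prob_integral P g = (prob_integral Q1 g + prob_integral Q2 g) / 2 :> R.
Proof.
move=> PQ; have mT := @measurableT _ (borel X).
have : (\int[measure_add P P]_x (sval g x)%:E = \int[measure_add Q1 Q2]_x (sval g x)%:E)%E.
  apply: eq_measure_integral => S mS _.
  transitivity (P S + P S)%E; first exact: measure_addE.
  by rewrite PQ//; symmetry; exact: measure_addE.
rewrite (integral_measure_add mT (bcfun_integrable P g) (bcfun_integrable P g)).
rewrite (integral_measure_add mT (bcfun_integrable Q1 g) (bcfun_integrable Q2 g)).
rewrite /= !prob_integralE -!EFinD => -[]; move: (prob_integral P g) => p.
by move: (prob_integral Q1 g) (prob_integral Q2 g) => q1 q2 /= E; rewrite -E; field.
Qed.

(** * Limits of ultrafilters on [L_C] *)

Section compactness.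
Context {R : realType} {n : nat} {Om : ptopologicalType}.
Context {Y U : 'I_n -> ptopologicalType}.

Local Notation MS := (MS Om Y).
Local Notation XS := (XS Om Y U).
Local Notation leb := (@lebesgue_measure R).
Local Notation I01c := (`[0%R, 1%R]%classic : set (measurableTypeR R)).

Variables (mu : probability (borel MS) R).
Context {J : countType} {cM : J -> MS -> R} {cU : forall k, nat -> U k -> R}.
Hypothesis cM_base : cozero_base cM.
Hypothesis cU_base : forall k, cozero_base (@cU k).
Hypothesis hU : forall k, hausdorff_space (U k).
Hypothesis cK : compact (L_R mu : set (weakP R XS)).

Let cX := cozero_base_rect cM_base cU_base.

Let tests (i : nat) : bcfun R XS :=
  test_bc cX (if unpickle i is Some k then k else ([::], 0%N)).

Let tests_separate (P Q : probability (borel XS) R) :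
  (forall i, prob_integral P (tests i) = prob_integral Q (tests i) :> R) ->
  forall B, measurable B -> P B = Q B.
Proof.
move=> PQ; apply: (@eq_probability_tests R XS _ _ cX) => k.
by have := PQ (pickle k); rewrite /tests pickleK.
Qed.

Lemma measurable_unit_cube : measurable (@unit_cube R n : set (borel (W R n))).
Proof.
have -> : @unit_cube R n = \bigcap_k ((fun z : W R n => z k) @^-1` `[0, 1]%classic).
  apply/seteqP; split=> z; first by move=> z01 k _; rewrite /= in_itv /=; exact: z01.
  by move=> z01 k; have := z01 k I; rewrite /= in_itv.
apply: measurable_bigcap_ord => k.
rewrite -[X in measurable X]setTI; apply: continuous_measurable_real => //.
exact: (@dprod_proj_continuous n (fun=> R : ptopologicalType) k).
Qed.

(** An integral against [P] is an [eta]-average of integrals against strategic measures, and these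
    lie in [L_R]. This is the domination that [choquet] asks of [L]. *)
Lemma L_C_prob_integral_le (P : weakP R XS) (g : bcfun R XS) (c : R) : L_C mu P ->
  (forall Q : weakP R XS, L_R mu Q -> prob_integral Q g <= c) -> prob_integral P g <= c.
Proof.
move=> [eta [pol [Q [eta1 [Qpol [mQ PE]]]]]] gc.
have mcube := measurable_unit_cube.
have mI (f : bcfun R XS) : measurable_fun (@unit_cube R n : set (borel (W R n)))
    (fun z => prob_integral (Q z) f).
  have cf := @continuous_measurable_real R (weakP R XS) _ (@prob_integral_continuous R XS f).
  exact: (measurableT_comp cf mQ).
have mH := @measurable_probability_tests R XS _ _ cX _ (borel (W R n)) _ Q mcube (fun k => mI _).
have [_ E] := prob_integral_mixture mcube eta1 mH PE g.
rewrite -lee_fin -E.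
have -> : c%:E = (\int[eta]_(z in @unit_cube R n) c%:E)%E.
  transitivity (c%:E * eta (@unit_cube R n))%E; first by rewrite eta1 mule1.
  by symmetry; exact: (integral_cst eta mcube c%:E).
apply: le_integral => //.
- apply: measurable_bounded_integrable => //.
  + by apply: le_lt_trans (probability_le1 eta mcube) _; exact: ltry.
  + have [_ [M gM]] := svalP g; exists M; split; first exact: num_real.
    by move=> N MN z _ /=; apply: le_trans (prob_integral_norm_le _ gM) (ltW MN).
- exact: finite_measure_integrable_cst.
move=> z /set_mem zc; rewrite lee_fin; apply: gc; apply: L_A_sub_L_R.
by have [mz sz] := Qpol z zc; exists (pol z).
Qed.

Lemma L_A_of_no_affine_midpoint (P : weakP R XS) : L_R mu P ->
  (forall Q1 Q2 : weakP R XS, L_R mu Q1 -> L_R mu Q2 ->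
    (forall g : bcfun R XS, prob_integral P g = (prob_integral Q1 g + prob_integral Q2 g) / 2 :> R) ->
    forall g : bcfun R XS, prob_integral Q1 g = prob_integral Q2 g :> R) ->
  L_A mu P.
Proof.
move=> PR mid; apply: (L_A_of_no_midpoint cM_base cU_base (@hU) PR) => Q1 Q2 Q1R Q2R PQ.
apply: tests_separate => i; apply: mid => // g; exact: prob_integral_midpoint.
Qed.

(** Measurability of each single integral has to be upgraded to Borel measurability into [weakP],
    whose open sets may be uncountable unions; compactness of [L_R] allows it. The value [P0] fills
    in outside [D]. *)
Lemma measurable_selection (psi : measurableTypeR R -> weakP R XS)
    (D : set (measurableTypeR R)) (P0 : weakP R XS) :
  measurable D -> (forall t, D t -> L_R mu (psi t)) ->
  (forall g : bcfun R XS, measurable_fun D (fun t => prob_integral (psi t) g : R)) ->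
  measurable_fun setT ((fun t => if pselect (D t) then psi t else P0) :
    measurableTypeR R -> borel (weakP R XS)).
Proof.
move=> mD DK mpsi.
apply: (@measurability _ _ _ (borel (weakP R XS)) _ _ open) => //.
move=> _ [V oV <-]; rewrite setTI.
have mV : measurable (D `&` psi @^-1` V).
  apply: (@measurable_preimage_open R (weakP R XS) (L_R mu)
    (fun i P => prob_integral P (tests i)) cK) => //.
  - by move=> i; exact: prob_integral_continuous.
  - by move=> i; exact: mpsi.
  - move=> P Q _ _ VP PQ; apply: (weakP_indistinguishable oV VP) => g.
    by apply: eq_prob_integral; exact: tests_separate.
have -> : (fun t => if pselect (D t) then psi t else P0) @^-1` V =
    (D `&` psi @^-1` V) `|` (~` D `&` (if pselect (V P0) then setT else set0)).
  apply/seteqP; split=> t /=; case: (pselect (D t)) => Dt.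
  - by left.
  - by move=> VP0; right; split => //; case: pselect.
  - by move=> [[]|[]].
  - by move=> [[]//|[_]]; case: pselect.
apply: measurableU => //; apply: measurableI; first exact: measurableC.
by case: pselect => VP0; [exact: measurableT|exact: measurable0].
Qed.

(** [[0, 1]] is embedded diagonally in the cube and [lam] pushed forward; coordinate [k0] recovers
    the parameter, which takes at least one agent. *)
Lemma L_C_of_curve (k0 : 'I_n) (psi : measurableTypeR R -> weakP R XS)
    (P : weakP R XS) (lam : probability (measurableTypeR R) R) :
  lam I01c = 1%E ->
  (forall t, L_A mu (psi t)) ->
  measurable_fun setT (psi : measurableTypeR R -> borel (weakP R XS)) ->
  (forall B : set (borel XS), measurable B -> P B = \int[lam]_(t in I01c) psi t B)%E ->
  L_C mu P.
Proof.
move=> lam1 psiA mpsi PE.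
pose delta (t : measurableTypeR R) : borel (W R n) := fun _ => t.
have mdelta : measurable_fun setT delta.
  apply: (@measurability _ _ _ (borel (W R n)) _ _ open) => //.
  move=> _ [V oV <-]; rewrite setTI; apply: open_measurable.
  have /continuousP : continuous (fun t : R => (fun _ => t) : W R n).
    by apply: (@continuous_dprod n (fun=> R : ptopologicalType)) => k t; exact: cvg_id.
  exact.
have mcube := measurable_unit_cube.
have cubeE : delta @^-1` (@unit_cube R n) = I01c.
  apply/seteqP; split=> t /=; rewrite in_itv /=; first by move=> /(_ k0).
  by move=> t01 k.
have [eta etaE] := pushforward_probability lam mdelta.
pose Q (z : W R n) := psi (z k0).
pose pol (z : W R n) := sval (cid (psiA (z k0))).
have mQ : measurable_fun setT (Q : borel (W R n) -> borel (weakP R XS)).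
  apply: (measurableT_comp mpsi); apply: continuous_measurable_real.
  exact: (@dprod_proj_continuous n (fun=> R : ptopologicalType) k0).
exists eta, pol, Q; split; [|split; [|split]].
- by rewrite etaE// cubeE.
- by move=> z _; exact: (svalP (cid (psiA (z k0)))).
- exact: measurable_funS mQ.
- move=> B mB; rewrite PE//.
  have mQB : measurable_fun setT (fun z : borel (W R n) => Q z B).
    apply: (@measurable_probability_tests R XS _ _ cX _ (borel (W R n)) _ Q) => // k.
    have cf := @continuous_measurable_real R (weakP R XS) _
      (@prob_integral_continuous R XS (test_bc cX k)).
    exact: (measurableT_comp cf mQ).
  transitivity (\int[pushforward lam delta]_(z in @unit_cube R n) Q z B)%E.
    rewrite (ge0_integral_pushforward mdelta) ?cubeE//.
    exact: measurable_funS mQB.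
  by apply: eq_measure_integral => S mS _; symmetry; exact: etaE.
Qed.

(* [L], the limit of the integrals along an ultrafilter on [L_C], is dominated by the
   support function of [L_R], so Choquet represents it by a curve in [L_R]; the
   curve avoids midpoints almost everywhere, hence can be chosen in [L_A]. *)
Lemma L_C_ultra_limit (k0 : 'I_n) (F : set_system (weakP R XS)) :
  UltraFilter F -> F (L_C mu) -> exists P : weakP R XS, L_C mu P /\ F --> P.
Proof.
move=> UF FC; have PF : ProperFilter F by exact: ultra_proper.
have [PA PAA] : exists P : weakP R XS, L_A mu P.
  have [P [eta [pol [Q [_ [Qpol _]]]]]] := filter_ex FC.
  have /Qpol[mz sz] : @unit_cube R n (fun=> 0) by move=> k; rewrite lexx ler01.
  by exists (Q (fun=> 0)), (pol (fun=> 0)).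
pose ev (g : bcfun R XS) (P : weakP R XS) : R := prob_integral P g.
pose L (h : weakP R XS -> R) : R := lim (h x @[x --> F]).
have ev_cvg g : ev g P @[P --> F] --> L (ev g).
  have [_ [M gM]] := svalP g.
  have [l hl] := ultra_bounded_cvg UF (fun P => prob_integral_norm_le P gM).
  by rewrite /L (cvg_lim _ hl).
(* Integrals of test functions are affine in the measure; midpoints with respect to them are
   midpoints of measures. *)
pose D : set (weakP R XS -> R) := range ev.
have evD g h : ev (add_bcfun g h) = ev g + ev h.
  by apply/funext => P; exact: prob_integralD.
have evZ c g : ev (scale_bcfun c g) = c *: ev g.
  by apply/funext => P; exact: prob_integralZ.
have [||||||||||psi [psiK psiI psi_ae]] := @choquet R (weakP R XS) (L_R mu) D L
  (fun i => ev (tests i)) cK.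
- move=> c; exists (cst_bcfun c) => //.
  by apply/funext => P; exact: prob_integral_cst.
- by move=> _ _ [g _ <-] [h _ <-]; exists (add_bcfun g h).
- by move=> c _ [g _ <-]; exists (scale_bcfun c g).
- by move=> _ [g _ <-]; exact: prob_integral_continuous.
- move=> _ _ [g _ <-] [h _ <-]; apply: cvg_lim => //.
  by apply: cvgD; exact: ev_cvg.
- move=> c _ [g _ <-]; apply: cvg_lim => //.
  by apply: cvgM; [exact: cvg_cst|exact: ev_cvg].
- move=> _ c [g _ <-] gc; apply: (cvgr_to_le (ev_cvg g)).
  by apply: filterS FC => P PC; apply: L_C_prob_integral_le PC gc.
- by move=> i; exists (tests i).
- move=> i P; apply: prob_integral_norm_le => x.
  by have /andP[t0 t1] := test_fun01 cX (if unpickle i is Some k then k else ([::], 0%N)) x; rewrite ger0_norm.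
- move=> _ [g _ <-] P Q _ _ PQ; apply: eq_prob_integral; exact: tests_separate.
have [N [mN N0 Nae]] := psi_ae.
pose G : set (measurableTypeR R) := `[0%R, 1%R[%classic `\` N.
have mI01 : measurable (`[0%R, 1%R[%classic : set (measurableTypeR R)).
  exact: measurable_itv.
have mG : measurable G by exact: measurableD.
have GA t : G t -> L_A mu (psi t).
  move=> [t01 Nt]; apply: L_A_of_no_affine_midpoint; first exact: psiK.
  move=> Q1 Q2 Q1R Q2R mid g.
  have mid_t : forall x y : weakP R XS, L_R mu x -> L_R mu y ->
      (forall h, D h -> h (psi t) = (h x + h y) / 2) -> forall h, D h -> h x = h y.
    apply: contrapT => nmid; apply: Nt; apply: Nae => /= H; apply: nmid.
    exact: H t01.
  apply: (mid_t Q1 Q2 Q1R Q2R _ (ev g)); last by exists g.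
  by move=> _ [h _ <-]; exact: mid.
(* The curve is redefined on the null set [N] and outside the unit interval, to lie in [L_A] at
   every parameter as [L_C] demands. *)
pose psi' t := if pselect (G t) then psi t else PA.
have psi'A t : L_A mu (psi' t) by rewrite /psi'; case: pselect => // Gt; exact: GA.
have mpsi g : measurable_fun (`[0%R, 1%R[%classic : set (measurableTypeR R)) (ev g \o psi).
  by have [] := psiI (ev g) (ex_intro2 _ _ g I erefl).
have mpsi' : measurable_fun setT (psi' : measurableTypeR R -> borel (weakP R XS)).
  apply: measurable_selection => //.
  - by move=> t [t01 _]; exact: psiK.
  - by move=> g; apply: measurable_funS (mpsi g) => // t [].
have mI : measurable I01c by exact: measurable_itv.
have leb1 : leb I01c = 1%E.
  by rewrite /= lebesgue_measure_itv /= lte_fin ltr01 oppr0 adde0.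
have [lam lamE] := @probability_of_set_function R _ (measurableTypeR R) (mrestr leb mI)
  (measure0 _) (measure_ge0 _) (@measure_semi_sigma_additive _ _ _ (mrestr leb mI))
  (etrans (congr1 leb (setTI I01c)) leb1).
have lam1 : lam I01c = 1%E by rewrite lamE /mrestr setIid.
have mev' g : measurable_fun setT (ev g \o psi' : measurableTypeR R -> R).
  have cf := @continuous_measurable_real R (weakP R XS) _ (@prob_integral_continuous R XS g).
  exact: (measurableT_comp cf mpsi').
have mH B : measurable B -> measurable_fun I01c (fun t => psi' t B).
  move=> mB; apply: (@measurable_probability_tests R XS _ _ cX _ (measurableTypeR R)) => // k.
  exact: measurable_funS (mev' _).
have [P PE] := mixture_probability mI lam1 mH.
exists P; split; first exact: (L_C_of_curve k0 lam1 psi'A mpsi').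
apply: cvg_weakP => g.
suff -> : prob_integral P g = L (ev g) by exact: ev_cvg.
have [_ E] := prob_integral_mixture mI lam1 mH (fun B _ => PE B) g.
apply: EFin_inj; rewrite -E.
transitivity (\int[leb]_(t in I01c) (ev g (psi' t))%:E)%E.
  apply: eq_measure_integral => S mS SI.
  by transitivity (leb (S `&` I01c)); [exact: lamE|rewrite setIidl].
have [_ <-] := psiI (ev g) (ex_intro2 _ _ g I erefl).
(* [choquet] works on the half-open interval and the cube is closed; the endpoint 1 has measure
   zero. *)
transitivity (\int[leb]_(t in `[0%R, 1%R[) (ev g (psi' t))%:E)%E.
  symmetry; apply: integral_itv_bndo_bndc; apply/measurable_EFinP.
  exact: measurable_funS (mev' g).
apply: ae_eq_integral => //.
- by apply/measurable_EFinP; exact: measurable_funS (mev' g).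
- by apply/measurable_EFinP; exact: mpsi.
- exists N; split => // t /= nE; apply: contrapT => Nt; apply: nE => t01.
  by rewrite /psi'; case: pselect => // -[]; split.
Qed.

End compactness.

(* With no decision maker the team policy is unique, hence so is the strategic measure. *)
Lemma L_C_no_agent {R : realType} (n : nat) {Om : ptopologicalType}
    {Y U : 'I_n -> ptopologicalType} (mu : probability (borel (MS Om Y)) R)
    (P Q : weakP R (XS Om Y U)) : n = 0%N -> L_C mu P -> L_C mu Q ->
  forall B : set (borel (XS Om Y U)), measurable B -> P B = Q B.
Proof.
move=> n0 PC QC B mB.
have g0 : team_policy Y U by move=> k y; exact: point.
suff E (P' : weakP R (XS Om Y U)) : L_C mu P' -> P' B = mu (strat_map g0 @^-1` B).
  by rewrite !E.
move=> [eta [pol [H [eta1 [Hpol [_ PE]]]]]]; rewrite PE//.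
transitivity (\int[eta]_(z in @unit_cube R n) mu (strat_map g0 @^-1` B))%E.
  apply: eq_integral => z /set_mem /Hpol[_ ->//]; congr (mu (strat_map _ @^-1` B)).
  apply/functional_extensionality_dep => k; exfalso.
  by case: k => m; rewrite n0.
transitivity (mu (strat_map g0 @^-1` B) * eta (@unit_cube R n))%E; last by rewrite eta1 mule1.
by apply: (integral_cst eta); exact: measurable_unit_cube.
Qed.

Theorem theorem2 (R : realType) (n : nat)
  (Om : completePseudoMetricType R) (Y U : 'I_n -> completePseudoMetricType R)
  (hOm : polish Om) (hY : forall k, polish (Y k)) (hU : forall k, polish (U k))
  (mu : probability (borel (MS Om (fun k => Y k : ptopologicalType))) R) :
  compact (L_R (U := fun k => U k : ptopologicalType) mu) ->
  compact (L_C (U := fun k => U k : ptopologicalType) mu).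
Proof.
move=> cK.
have base (T : completePseudoMetricType R) : polish T ->
    exists c : nat -> T -> R, cozero_base c.
  by move=> [_ [D [cD dD]]]; exact: cozero_base_separable point cD dD.
have [cO cO_base] := base _ hOm.
pose cY k := sval (cid (base _ (hY k))); pose cU k := sval (cid (base _ (hU k))).
have cY_base k : cozero_base (cY k) := svalP (cid (base _ (hY k))).
have cU_base k : cozero_base (cU k) := svalP (cid (base _ (hU k))).
have cM_base := cozero_base_prod cO_base
  (@cozero_base_dprod R n (fun k => Y k : ptopologicalType) (fun=> nat) cY cY_base).
(* Dependent functions on ['I_n] are replaced by finite functions, whose type is countable. *)
have {}cM_base := @cozero_base_reindex _ _ _ (nat * {ffun 'I_n -> nat})%type _
  (fun ja => (ja.1, fun k => ja.2 k)) cM_base _.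
have {}cM_base := cM_base (ltac:(
  move=> ja; exists (ja.1, [ffun k => ja.2 k]) => z /=; congr (_ * _);
  by apply: eq_bigr => k _; rewrite ffunE)).
rewrite compact_ultra => F UF FC.
(* Without agents the cube is a single point and has no room for a parameter; then all elements of
   [L_C] agree on measurable sets, so any one of them is a limit. *)
have [n0|[k0 _]] : n = 0%N \/ exists k0 : 'I_n, True.
  by case: (n) => [|m]; [left|right; exists ord0].
  have PF : ProperFilter F by exact: ultra_proper.
  have [P PC] := filter_ex FC; exists P; split => //.
  apply: cvg_weakP => g; apply: cvg_near_cst; apply: filterS FC => Q QC.
  by apply: eq_prob_integral => B mB; exact: (L_C_no_agent n0 QC PC).
have [P [PC FP]] := L_C_ultra_limit cM_base cU_base (fun k => (hU k).1) cK k0 UF FC.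
by exists P.
Qed.
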